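(* Let $k$ be a real number and define $H_k=\frac{\pi}{2\sqrt{k}}$ if $k>0$, $H_k=\infty$ if $k=0$, and $H_k=\frac{1.3877}{\sqrt{-k}}$ if $k<0$. Suppose $(X,d)$ is a CAT($k$) space. Then for any metric triple $T=\{A,B,C\}$ in $X$ with $\max\{d(A,B),d(A,C),d(B,C)\}\le H_k$, it holds that $k_X(T)\le k$.
   Context: **Model spaces.** For a real number $k$, $M_k^2$ with distance $|\cdot|_k$ is the simply connected complete surface of constant curvature $k$ (the Euclidean plane for $k=0$; the unit sphere with distance multiplied by $1/\sqrt{k}$ for $k>0$; the hyperbolic plane with distance multiplied by $1/\sqrt{-k}$ for $k<0$). $D_k=\pi/\sqrt{k}$ for $k>0$ and $D_k=\infty$ for $k\le 0$. **CAT($k$) space.** A geodesic metric space $(X,d)$ is CAT($k$) if every geodesic triangle $\Delta ABC$ in $X$ with perimeter less than $2D_k$ satisfies the following: if $\Delta A'B'C'$ is a comparison triangle in $M_k^2$ (same side lengths as $\Delta ABC$), then for any point $D$ on the edge $BC$, with corresponding point $D'$ on the edge $B'C'$ (i.e. $d(B,D)=|B'D'|_k$ and $d(C,D)=|C'D'|_k$), one has $d(A,D)\le |A'D'|_k$. (The labelling of vertices is arbitrary.) **The function $S$.** Let $a,b,c\in(0,\infty)$ with $a\le b\le c\le a+b$ and $k\in(-\infty,(\frac{2\pi}{a+b+c})^2]$. There is a triangle $\Delta ABC$ in $M_k^2$ with $|BC|_k=a$, $|AC|_k=b$, $|AB|_k=c$, and one sets $S(a,b,c,k)=\min_{P\in\Delta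 ABC}\{|PA|_k+|PB|_k+|PC|_k\}$, where $P$ ranges over the closed triangular region; the value is independent of the choice of triangle. $S$ is extended to be symmetric in $a,b,c$. Convention: $S(a,b,c,-\infty)=\lim_{k\to-\infty}S(a,b,c,k)=\frac{a+b+c}{2}$. **The number $\Lambda(a,b,c)$.** For $a\le b\le c\le a+b$, $\Lambda(a,b,c)=k^*$ where: $k^*=0$ if $c^2=a^2+b^2+ab$; if $c^2<a^2+b^2+ab$, $k^*\in(0,(\frac{2\pi}{a+b+c})^2]$ is the number with $\cos(c\sqrt{k^*})=\cos(a\sqrt{k^*})\cos(b\sqrt{k^*})-\frac12\sin(a\sqrt{k^*})\sin(b\sqrt{k^*})$; if $c^2>a^2+b^2+ab$, $k^*<0$ is the number with $\cosh(c\sqrt{-k^*})=\cosh(a\sqrt{-k^*})\cosh(b\sqrt{-k^*})+\frac12\sinh(a\sqrt{-k^*})\sinh(b\sqrt{-k^*})$. Convention: $\Lambda(a,b,c)=-\infty$ if $c=a+b$. **Curvature of a triple.** A metric triple in a metric space $(X,d)$ is a set $T=\{p_1,p_2,p_3\}\subseteq X$ of three distinct points with mutual distances $d_{ij}=d(p_i,p_j)$, labelled so that $d_{12}\le d_{23}\le d_{13}\le d_{12}+d_{23}$. Put $g_X(T)=\inf_{x\in X}\sum_{i=1}^3 d(p_i,x)$. The curvature $k_X(T)$ is the number $k\in[-\infty,\Lambda(d_{12},d_{23},d_{13})]$ such that $g_X(T)=S(d_{12},d_{23},d_{13},k)$. *)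

(* Defs.v *)
From HB Require Import structures.
From mathcomp Require Import all_boot all_order all_algebra.
From mathcomp Require Import all_classical all_reals all_analysis.
Set Implicit Arguments.
Unset Strict Implicit.
Unset Printing Implicit Defensive.
Import Order.TTheory GRing.Theory Num.Theory.
Local Open Scope classical_set_scope.
Local Open Scope ring_scope.

Definition cosh (R : realType) (x : R) : R := (expR x + expR (- x)) / 2.
Definition sinh (R : realType) (x : R) : R := (expR x - expR (- x)) / 2.

(* The inverse of [cosh] on [1, +oo[; the value at x < 1 is irrelevant. *)
Definition arcosh (R : realType) (x : R) : R := ln (x + Num.sqrt (x ^+ 2 - 1)).

(* The three kinds of model surface are realized in R^3 as subsets of
   {x | <x, x> = 1}, where <x, y> = x0 y0 + sg(k) (x1 y1 + x2 y2):
   the unit sphere if k > 0, the affine plane x0 = 1 if k = 0, and the upper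
   sheet of the hyperboloid x0^2 - x1^2 - x2^2 = 1 if k < 0. *)
Definition model_form (R : realType) (k : R) (x y : R * R * R) : R :=
  let: (x0, x1, x2) := x in
  let: (y0, y1, y2) := y in
  x0 * y0 + Num.sg k * (x1 * y1 + x2 * y2).

Definition model_space (R : realType) (k : R) : set (R * R * R) :=
  [set x | model_form k x x = 1 /\ (k <= 0 -> 0 < x.1.1)].

Definition model_dist (R : realType) (k : R) (x y : R * R * R) : R :=
  if 0 < k then acos (model_form k x y) / Num.sqrt k
  else if k < 0 then arcosh (model_form k x y) / Num.sqrt (- k)
  else Num.sqrt ((x.1.1 - y.1.1) ^+ 2 + (x.1.2 - y.1.2) ^+ 2
                 + (x.2 - y.2) ^+ 2).

Definition model_diam (R : realType) (k : R) : \bar R :=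
  if 0 < k then (pi / Num.sqrt k)%:E else +oo%E.

Definition model_segment (R : realType) (k : R) (x y : R * R * R) :
    set (R * R * R) :=
  [set z | model_space k z /\
           model_dist k x z + model_dist k z y = model_dist k x y].

(* The closed triangular region, swept out by the segments from A to the
   points of the opposite edge.  If the perimeter is 2 pi / sqrt k, this set
   is the whole sphere; when the triangle is a great circle, the reflection in
   it shows that the minimum in [minS] below is the same as over either of
   the two hemispheres it bounds, and when two vertices are antipodal, both
   minima are equal to the longest side. *)
Definition model_triangle (R : realType) (k : R) (A B C : R * R * R) :
    set (R * R * R) :=
  [set P | exists2 D, model_segment k B C D & model_segment k A D P].

Section Geodesics.
Variables (R : realType) (X : metricType R).

(* [g] is only constrained on the interval [0, mdist x y]. *)
Definition geodesic (x y : X) (g : R -> X) : Prop :=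
  [/\ g 0 = x, g (mdist x y) = y &
      {in `[0, mdist x y] &, forall s t, mdist (g s) (g t) = `|s - t|}].

Definition geodesic_space : Prop := forall x y : X, exists g, geodesic x y g.

Definition CAT (k : R) : Prop :=
  geodesic_space /\
  forall (A B C : X) (gAB gBC gAC : R -> X),
    geodesic A B gAB -> geodesic B C gBC -> geodesic A C gAC ->
    ((mdist A B + mdist B C + mdist A C)%:E < 2%:E * model_diam k)%E ->
  forall A' B' C' : R * R * R,
    model_space k A' -> model_space k B' -> model_space k C' ->
    model_dist k A' B' = mdist A B ->
    model_dist k B' C' = mdist B C ->
    model_dist k A' C' = mdist A C ->
  forall (t : R) (D' : R * R * R),
    t \in `[0, mdist B C] ->
    model_space k D' ->
    model_dist k B' D' = mdist B (gBC t) ->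
    model_dist k C' D' = mdist C (gBC t) ->
    mdist A (gBC t) <= model_dist k A' D'.

End Geodesics.

(* [minS a b c k s] is the graph of the function S: it says s = S(a, b, c, k),
   for a <= b <= c <= a + b, including the convention for k = -oo. *)
Definition minS (R : realType) (a b c : R) (k : \bar R) (s : R) : Prop :=
  match k with
  | k%:E =>
    k <= (2 * pi / (a + b + c)) ^+ 2 /\
    exists A B C : R * R * R,
    [/\ [/\ model_space k A, model_space k B & model_space k C],
        [/\ model_dist k B C = a, model_dist k A C = b &
            model_dist k A B = c],
        exists2 P, model_triangle k A B C P &
          s = model_dist k P A + model_dist k P B + model_dist k P C &
        forall P, model_triangle k A B C P ->
          s <= model_dist k P A + model_dist k P B + model_dist k P C]
  | -oo%E => s = (a + b + c) / 2
  | +oo%E => False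
  end.

(* The graph of Lambda: [isLambda a b c l] says l = Lambda(a, b, c),
   for a <= b <= c <= a + b. *)
Definition isLambda (R : realType) (a b c : R) (l : \bar R) : Prop :=
  match l with
  | k%:E =>
    c < a + b /\
    [\/ c ^+ 2 = a ^+ 2 + b ^+ 2 + a * b /\ k = 0,
        [/\ c ^+ 2 < a ^+ 2 + b ^+ 2 + a * b,
            0 < k <= (2 * pi / (a + b + c)) ^+ 2 &
            let r := Num.sqrt k in
            cos (c * r) =
              cos (a * r) * cos (b * r) - 1 / 2 * (sin (a * r) * sin (b * r))] |
        [/\ c ^+ 2 > a ^+ 2 + b ^+ 2 + a * b,
            k < 0 &
            let r := Num.sqrt (- k) in
            cosh (c * r) =
              cosh (a * r) * cosh (b * r)
              + 1 / 2 * (sinh (a * r) * sinh (b * r))]]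
  | -oo%E => c = a + b
  | +oo%E => False
  end.

Section Curvature.
Variables (R : realType) (X : metricType R).

Definition min_sum_dist (p1 p2 p3 : X) : R :=
  inf (range (fun x : X => mdist p1 x + mdist p2 x + mdist p3 x)).

(* [triple_curvature T k] says that k = k_X(T). *)
Definition triple_curvature (T : set X) (k : \bar R) : Prop :=
  exists p1 p2 p3 : X,
  let d12 := mdist p1 p2 in
  let d23 := mdist p2 p3 in
  let d13 := mdist p1 p3 in
  [/\ T = [set p1; p2; p3],
      [/\ p1 <> p2, p1 <> p3 & p2 <> p3],
      [/\ d12 <= d23, d23 <= d13 & d13 <= d12 + d23],
      exists2 l, isLambda d12 d23 d13 l & (k <= l)%E &
      minS d12 d23 d13 k (min_sum_dist p1 p2 p3)].

End Curvature.

Definition size_bound (R : realType) (k : R) : \bar R :=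
  if 0 < k then (pi / (2 * Num.sqrt k))%:E
  else if k < 0 then ((1 + 3877 / 10 ^+ 4) / Num.sqrt (- k))%:E
  else +oo%E.

(* Main.v *)
Require Import Defs.
From HB Require Import structures.
From mathcomp Require Import all_boot all_order all_algebra.
From mathcomp Require Import all_classical all_reals all_analysis.
From mathcomp Require Import ring lra.
Import Order.TTheory GRing.Theory Num.Theory.
Import numFieldNormedType.Exports.
Local Open Scope classical_set_scope.
Local Open Scope ring_scope.

(** Both sides of the inequality are about tripods: three legs p, q, r that issue
from one point and end at points whose mutual distances are a = |qr|,
b = |pr|, c = |pq|.

Let l be the curvature of the triple and suppose that k < l.  In the model
surface of curvature l, the point of the triangle that minimizes the sum of
the distances to the vertices gives legs p', q', r' of sum g, the infimum of
the sum of the distances in X.  Minimality, and l <= Lambda when the minimizer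
is a vertex, bounds each of the three angles of this tripod by 120 degrees
(model_fermat): each side is at most the third side of the 120 degree hinge
of curvature l on its two legs.

In X take points whose sum of distances to A, B, C tends to g, and let
(p, q, r) be a limit of their distances to A, B, C.  If the comparison angle
between two legs, say p and q, were less than 120 degrees, then there would be
a point D of AB whose direction makes comparison angles of less than 60 degrees
with those of A and B; moving towards D would shorten p and q at a rate larger
than 1/2 each, and lengthen r at a rate at most 1.  So each comparison angle is
at least 120 degrees (inf_limit_angle): each side is at least the third side of the
120 degree hinge of curvature k on p, q, r.

Now 120 degree hinges with given legs get longer when the curvature decreases
(hinge120_curv, by Sturm comparison).  Hence in curvature k the hinges on
p, q, r are no longer than those on p', q', r', while p + q + r =
p' + q' + r'.  If two legs of the first tripod are at least the corresponding
ones of the second, monotonicity in the legs makes the two tripods equal.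
Otherwise two legs are shorter and the third has to make up for both; the
shortening of one of these two, by e, is at most half the lengthening of the
third, and lengthening one leg by 2 e while shortening the other by e
lengthens the hinge (hinge120_exchange), a contradiction.  So the tripods are
equal, and the strict decrease of some hinge with positive legs in the
curvature contradicts k < l (tripods_curv_le).  If k > 0, the bound on the size
of the triple keeps all the legs at most pi / (2 sqrt k), where this
monotonicity in the legs holds.

The three signs of the curvature are treated at once: distances d are
represented by squared chords chord2 k d, for which the law of cosines has the
same form in all curvatures. *)

(** * Trigonometry in curvature k *)

Section GeneralizedTrigonometry.
Set Implicit Arguments.
Unset Strict Implicit.
Context {R : realType}.
Implicit Types k x y z p q s u v : R.

(** The solution of f'' = - k f with f 0 = 0 and f' 0 = 1; cs is its derivative.
    As Num.sqrt k = 0 for k <= 0, a bound such as Num.sqrt k * x <= pi is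
    vacuous there, so that restrictions to the range of a spherical distance
    can be written without a case distinction on k. *)
Definition sn k x : R :=
  if 0 < k then sin (Num.sqrt k * x) / Num.sqrt k
  else if k < 0 then sinh (Num.sqrt (- k) * x) / Num.sqrt (- k) else x.

Definition cs k x : R :=
  if 0 < k then cos (Num.sqrt k * x)
  else if k < 0 then cosh (Num.sqrt (- k) * x) else 1.

(** Equal to 2 (1 - cs k x) / k if k <> 0, and to x^2 if k = 0.  The law of
    cosines for cs carries no information at k = 0; its form for chord2 does. *)
Definition chord2 k x : R := 4 * sn k (x / 2) ^+ 2.

Lemma sqr_sqrt_pos k : 0 < k -> Num.sqrt k ^+ 2 = k.
Proof. by move=> k0; rewrite sqr_sqrtr// ltW. Qed.

Lemma sqrt_npos k : k <= 0 -> Num.sqrt k = 0.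
Proof. by move=> k0; apply/eqP; rewrite sqrtr_eq0. Qed.

Lemma sinh0 : sinh (0 : R) = 0. Proof. by rewrite /sinh oppr0 subrr mul0r. Qed.
Lemma cosh0 : cosh (0 : R) = 1.
Proof. by rewrite /cosh oppr0 expR0 -[1 + 1]/(2%:R) divff// pnatr_eq0. Qed.

Lemma sinhD x y : sinh (x + y) = sinh x * cosh y + cosh x * sinh y.
Proof. by rewrite /sinh /cosh opprD !expRD; field. Qed.

Lemma coshD x y : cosh (x + y) = cosh x * cosh y + sinh x * sinh y.
Proof. by rewrite /sinh /cosh opprD !expRD; field. Qed.

Lemma sinhN x : sinh (- x) = - sinh x.
Proof. by rewrite /sinh opprK; field. Qed.

Lemma coshN x : cosh (- x) = cosh x.
Proof. by rewrite /cosh opprK addrC. Qed.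

Lemma sinh_gt0 x : 0 < x -> 0 < sinh x.
Proof.
by move=> x0; rewrite /sinh divr_gt0// subr_gt0 ltr_expR; lra.
Qed.

Lemma cosh_gt0 x : 0 < cosh x.
Proof. by rewrite /cosh divr_gt0// addr_gt0// expR_gt0. Qed.

Global Instance is_derive_sinh x : is_derive x 1 (@sinh R) (cosh x).
Proof.
rewrite /sinh; eapply is_derive_eq; first typeclasses eauto.
by rewrite /cosh /GRing.scale/=; field.
Qed.

Global Instance is_derive_cosh x : is_derive x 1 (@cosh R) (sinh x).
Proof.
rewrite /cosh; eapply is_derive_eq; first typeclasses eauto.
by rewrite /sinh /GRing.scale/=; field.
Qed.

Lemma sqrt_neq0 k : 0 < k -> Num.sqrt k != 0.
Proof. by move=> k0; rewrite gt_eqF// sqrtr_gt0. Qed.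

Lemma sn0 k : sn k 0 = 0.
Proof. by rewrite /sn !mulr0 sin0 sinh0 !mul0r; case: (ltrgt0P k). Qed.

Lemma cs0 k : cs k 0 = 1.
Proof. by rewrite /cs !mulr0 cos0 cosh0; case: (ltrgt0P k). Qed.

Lemma snN k x : sn k (- x) = - sn k x.
Proof. by rewrite /sn !mulrN sinN sinhN !mulNr; case: (ltrgt0P k). Qed.

Lemma csN k x : cs k (- x) = cs k x.
Proof. by rewrite /cs !mulrN cosN coshN; case: (ltrgt0P k). Qed.

Lemma snD k x y : sn k (x + y) = sn k x * cs k y + cs k x * sn k y.
Proof.
rewrite /sn /cs !mulrDr sinD sinhD; case: (ltrgt0P k) => [k0|k0|k0].
- by rewrite mulrDl; ring.
- by rewrite mulrDl; ring.
- by rewrite !(mulr1, mul1r).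
Qed.

Lemma csD k x y : cs k (x + y) = cs k x * cs k y - k * (sn k x * sn k y).
Proof.
rewrite /sn /cs !mulrDr cosD coshD; case: (ltrgt0P k) => [k0|k0|k0].
- have h := sqrt_neq0 k0; move: (Num.sqrt k) h (sqr_sqrt_pos k0) => r h <-.
  by field.
- have k0' : 0 < - k by lra.
  have h := sqrt_neq0 k0'.
  move: (Num.sqrt (- k)) h (sqr_sqrt_pos k0') => r h hk.
  rewrite (_ : k = - r ^+ 2); last lra.
  by field.
- by rewrite k0 !(mulr1, mul0r, subr0).
Qed.

Lemma csDksn k x : cs k x ^+ 2 + k * sn k x ^+ 2 = 1.
Proof.
have := csD k x (- x).
by rewrite subrr cs0 csN snN => ->; ring.
Qed.

Lemma snB k x y : sn k (x - y) = sn k x * cs k y - cs k x * sn k y.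
Proof. by rewrite snD snN csN; ring. Qed.

Lemma csB k x y : cs k (x - y) = cs k x * cs k y + k * (sn k x * sn k y).
Proof. by rewrite csD snN csN; ring. Qed.

Global Instance is_derive_sn k x : is_derive x 1 (sn k) (cs k x).
Proof.
rewrite /sn /cs; case: (ltrgt0P k) => k0.
- have h := sqrt_neq0 k0.
  eapply is_derive_eq; first typeclasses eauto.
  by rewrite /GRing.scale/=; field.
- have k0' : 0 < - k by lra.
  have h := sqrt_neq0 k0'.
  eapply is_derive_eq; first typeclasses eauto.
  by rewrite /GRing.scale/=; field.
- exact: is_derive_id.
Qed.

Global Instance is_derive_cs k x : is_derive x 1 (cs k) (- k * sn k x).
Proof.
rewrite /sn /cs; case: (ltrgt0P k) => k0.
- have h := sqrt_neq0 k0.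
  eapply is_derive_eq; first typeclasses eauto.
  rewrite /GRing.scale/=; move: (Num.sqrt k) h (sqr_sqrt_pos k0) => r h <-.
  by field.
- have k0' : 0 < - k by lra.
  have h := sqrt_neq0 k0'.
  eapply is_derive_eq; first typeclasses eauto.
  rewrite /GRing.scale/=; move: (Num.sqrt (- k)) h (sqr_sqrt_pos k0') => r h <-.
  by field.
- rewrite k0 oppr0 mul0r; exact: is_derive_cst.
Qed.

Lemma continuous_sn k : continuous (sn k).
Proof.
by move=> x; apply/differentiable_continuous/derivable1_diffP; exact: ex_derive.
Qed.

Lemma sn_gt0 k x : 0 < x -> Num.sqrt k * x < pi -> 0 < sn k x.
Proof.
move=> x0 kx; rewrite /sn; case: (ltrgt0P k) => k0 //.
- by rewrite divr_gt0 ?sqrtr_gt0// sin_gt0_pi// kx mulr_gt0 ?sqrtr_gt0.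
- have k0' : 0 < Num.sqrt (- k) by rewrite sqrtr_gt0; lra.
  by rewrite divr_gt0// sinh_gt0// mulr_gt0.
Qed.

Lemma sn_ge0 k x : 0 <= x -> Num.sqrt k * x <= pi -> 0 <= sn k x.
Proof.
move=> x0 kx; rewrite /sn; case: (ltrgt0P k) => k0 //.
- by rewrite divr_ge0 ?sqrtr_ge0// sin_ge0_pi// kx mulr_ge0 ?sqrtr_ge0.
- have k0' : 0 < Num.sqrt (- k) by rewrite sqrtr_gt0; lra.
  move: x0; rewrite le_eqVlt => /orP[/eqP<-|x0].
    by rewrite mulr0 sinh0 mul0r.
  by rewrite divr_ge0 ?ltW// sinh_gt0// mulr_gt0.
Qed.

Lemma cs_gt0 k x : 0 <= x -> Num.sqrt k * x < pi / 2 -> 0 < cs k x.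
Proof.
move=> x0 kx; rewrite /cs; case: (ltrgt0P k) => k0 //.
- rewrite cos_gt0_pihalf// kx andbT (@lt_le_trans _ _ 0)//.
    by rewrite oppr_lt0 divr_gt0// pi_gt0.
  by rewrite mulr_ge0// sqrtr_ge0.
- exact: cosh_gt0.
Qed.

Lemma cs_ge0 k x : 0 <= x -> Num.sqrt k * x <= pi / 2 -> 0 <= cs k x.
Proof.
move=> x0 kx; rewrite /cs; case: (ltrgt0P k) => k0 //.
- rewrite cos_ge0_pihalf// kx andbT (@le_trans _ _ 0)//.
    by rewrite oppr_le0 divr_ge0// pi_ge0.
  by rewrite mulr_ge0// sqrtr_ge0.
- exact/ltW/cosh_gt0.
Qed.

Lemma csE k x : cs k x = 1 - k / 2 * chord2 k x.
Proof.
rewrite /chord2 {1}(_ : x = x / 2 + x / 2); last by field.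
rewrite csD; have := csDksn k (x / 2); lra.
Qed.

Lemma chord20 k : chord2 k 0 = 0.
Proof. by rewrite /chord2 mul0r sn0; ring. Qed.

Lemma chord2N k x : chord2 k (- x) = chord2 k x.
Proof. by rewrite /chord2 mulNr snN; ring. Qed.

(** Monotonicity and convexity properties of chord2 are read off from the sign
    of sn through this identity. *)
Lemma chord2B k x y :
  chord2 k x - chord2 k y = 4 * sn k ((x + y) / 2) * sn k ((x - y) / 2).
Proof.
rewrite /chord2 (mulrDl x) (mulrBl _ x) snB snD.
have := csDksn k (x / 2); have := csDksn k (y / 2).
move: (sn k (x / 2)) (sn k (y / 2)) (cs k (x / 2)) (cs k (y / 2)) => a b c d h1 h2.
have -> : 4 * (a * d + c * b) * (a * d - c * b) =
  4 * (a ^+ 2 * d ^+ 2 - c ^+ 2 * b ^+ 2) by ring.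
have -> : d ^+ 2 = 1 - k * b ^+ 2 by lra.
have -> : c ^+ 2 = 1 - k * a ^+ 2 by lra.
by ring.
Qed.

(** chord2 k is symmetric about pi / sqrt k, so that x may lie beyond this
    point provided that y is further away from it than x. *)
Lemma chord2_lt k x y : 0 <= y -> y < x -> Num.sqrt k * (x + y) < 2 * pi ->
  chord2 k y < chord2 k x.
Proof.
move=> y0 yx h; rewrite -subr_gt0 chord2B.
have kk := sqrtr_ge0 k.
rewrite mulr_gt0// ?mulr_gt0//; apply: sn_gt0; try lra.
have : Num.sqrt k * y >= 0 by rewrite mulr_ge0.
lra.
Qed.

Lemma chord2_ltD k x y : 0 <= y -> y < x -> Num.sqrt k * x <= pi ->
  chord2 k y < chord2 k x.
Proof.
move=> y0 yx h; have kk := sqrtr_ge0 k.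
apply: chord2_lt => //; have := pi_gt0 R.
have [k0|] := eqVneq (Num.sqrt k) 0; first by rewrite k0; lra.
move=> k0; have : Num.sqrt k * y < Num.sqrt k * x.
  by rewrite ltr_pM2l// lt_neqAle eq_sym k0.
lra.
Qed.

Lemma chord2_leD k x y : 0 <= y -> y <= x -> Num.sqrt k * x <= pi ->
  chord2 k y <= chord2 k x.
Proof.
move=> y0; rewrite le_eqVlt => /orP[/eqP->//|yx] h.
exact/ltW/chord2_ltD.
Qed.

Lemma le_of_chord2 k x y : 0 <= y -> Num.sqrt k * x <= pi ->
  chord2 k x <= chord2 k y -> x <= y.
Proof.
move=> y0 kx h; rewrite leNgt; apply/negP => yx.
by have := chord2_ltD y0 yx kx; rewrite ltNge h.
Qed.

Lemma chord2D k p q : chord2 k (p + q) =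
  chord2 k p + chord2 k q - k / 2 * chord2 k p * chord2 k q
  + 2 * sn k p * sn k q.
Proof.
have h : chord2 k (p + q) - chord2 k (p - q) = 4 * sn k p * sn k q.
  rewrite chord2B; congr (_ * sn k _ * sn k _); by field.
have h' : chord2 k (p + q) + chord2 k (p - q) =
  2 * chord2 k p + 2 * chord2 k q - k * chord2 k p * chord2 k q; last lra.
rewrite /chord2 (mulrDl p) (mulrBl _ p) snB snD.
have := csDksn k (p / 2); have := csDksn k (q / 2).
move: (sn k (p / 2)) (sn k (q / 2)) (cs k (p / 2)) (cs k (q / 2)) => a b c d h1 h2.
have -> : 4 * (a * d + c * b) ^+ 2 + 4 * (a * d - c * b) ^+ 2 =
  8 * (a ^+ 2 * d ^+ 2 + c ^+ 2 * b ^+ 2) by ring.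
have -> : d ^+ 2 = 1 - k * b ^+ 2 by lra.
have -> : c ^+ 2 = 1 - k * a ^+ 2 by lra.
by ring.
Qed.

Lemma chord2_sub k p q : chord2 k (p - q) =
  chord2 k p + chord2 k q - k / 2 * chord2 k p * chord2 k q
  - 2 * sn k p * sn k q.
Proof. by rewrite chord2D snN chord2N; ring. Qed.

Lemma sn2E k p : sn k p ^+ 2 = chord2 k p - k / 4 * chord2 k p ^+ 2.
Proof.
have h := chord2_sub k p p; rewrite subrr chord20 in h.
lra.
Qed.

Global Instance is_derive_chord2 k x : is_derive x 1 (chord2 k) (2 * sn k x).
Proof.
rewrite /chord2; eapply is_derive_eq; first typeclasses eauto.
have := snD k (x / 2) (x / 2); rewrite (_ : x / 2 + x / 2 = x); last by field.
by move=> ->; rewrite /GRing.scale/=; field.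
Qed.

Lemma continuous_chord2 k : continuous (chord2 k).
Proof.
by move=> x; apply/differentiable_continuous/derivable1_diffP; exact: ex_derive.
Qed.

End GeneralizedTrigonometry.

Typeclasses Opaque chord2 sn cs.

(** * Comparison of chords in two curvatures *)

Section CurvatureComparison.
Set Implicit Arguments.
Unset Strict Implicit.
Context {R : realType}.
Implicit Types k l x y z p q s u v a c e rho : R.

Lemma deriv_pos_lt (f df : R -> R) x y : x < y ->
  (forall z, x <= z -> z <= y -> is_derive z 1 f (df z)) ->
  (forall z, x < z -> z < y -> 0 < df z) -> f x < f y.
Proof.
move=> xy fd dpos.
have [||z zi E] := @MVT R f df x y xy.
- by move=> z zi; apply: fd; move: zi; rewrite in_itv/= => /andP[/ltW ? /ltW ?].
- apply: continuous_in_subspaceT => z; rewrite inE/= in_itv/= => /andP[xz zy].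
  have := fd z xz zy => h.
  by apply/differentiable_continuous/derivable1_diffP; exact: ex_derive.
- move: zi; rewrite in_itv/= => /andP[xz zy].
  by rewrite -subr_gt0 E mulr_gt0// ?dpos// subr_gt0.
Qed.

Lemma deriv_ge0_le (f df : R -> R) x y : x <= y ->
  (forall z, x <= z -> z <= y -> is_derive z 1 f (df z)) ->
  (forall z, x < z -> z < y -> 0 <= df z) -> f x <= f y.
Proof.
rewrite le_eqVlt => /orP[/eqP->//|xy] fd dpos.
have [||z zi E] := @MVT R f df x y xy.
- by move=> z zi; apply: fd; move: zi; rewrite in_itv/= => /andP[/ltW ? /ltW ?].
- apply: continuous_in_subspaceT => z; rewrite inE/= in_itv/= => /andP[xz zy].
  have := fd z xz zy => h.
  by apply/differentiable_continuous/derivable1_diffP; exact: ex_derive.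
- move: zi; rewrite in_itv/= => /andP[xz zy].
  by rewrite -subr_ge0 E mulr_ge0// ?dpos// subr_ge0 ltW.
Qed.

Lemma sqrtM_lt l x y c : x < y -> 0 < c -> Num.sqrt l * y <= c ->
  Num.sqrt l * x < c.
Proof.
move=> xy c0; have := sqrtr_ge0 l; rewrite le_eqVlt => /orP[/eqP<-|l0] h.
  by rewrite mul0r.
by apply: lt_le_trans h; rewrite ltr_pM2l.
Qed.

Lemma sqrtM_le l x y c : x <= y -> Num.sqrt l * y <= c -> Num.sqrt l * x <= c.
Proof.
by move=> xy; apply: le_trans; rewrite ler_wpM2l// sqrtr_ge0.
Qed.

Lemma sqrtM_mono k l x c : k <= l -> 0 <= x -> Num.sqrt l * x <= c ->
  Num.sqrt k * x <= c.
Proof. by move=> kl x0; apply: le_trans; rewrite ler_wpM2r// ler_wsqrtr. Qed.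

Lemma sqrtM_mono_lt k l x c : k <= l -> 0 <= x -> Num.sqrt l * x < c ->
  Num.sqrt k * x < c.
Proof. by move=> kl x0; apply: le_lt_trans; rewrite ler_wpM2r// ler_wsqrtr. Qed.

(** Sturm comparison: the derivative of this Wronskian is (l - k) sn_k sn_l. *)
Lemma sn_wronskian_gt0 k l x : k < l -> 0 < x -> Num.sqrt l * x <= pi ->
  0 < cs k x * sn l x - sn k x * cs l x.
Proof.
move=> kl x0 lx.
pose f z := cs k z * sn l z - sn k z * cs l z.
have -> : 0 = f 0 by rewrite /f !sn0 !cs0; ring.
apply: (@deriv_pos_lt f (fun z => (l - k) * (sn k z * sn l z))) => // z z0 zx.
  rewrite /f; eapply is_derive_eq; first typeclasses eauto.
  by rewrite /GRing.scale/=; ring.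
have h := sqrtM_lt zx (pi_gt0 R) lx.
rewrite !mulr_gt0 ?subr_gt0//; apply: sn_gt0 => //.
exact: sqrtM_mono_lt (ltW kl) (ltW z0) h.
Qed.

Lemma sn_ratio_lt k l x y : k < l -> 0 < x -> x < y -> Num.sqrt l * y < pi ->
  sn k x / sn l x < sn k y / sn l y.
Proof.
move=> kl x0 xy ly.
pose f z := sn k z / sn l z.
have ln z : x <= z -> z <= y -> 0 < z /\ Num.sqrt l * z < pi.
  move=> xz zy; split; first exact: lt_le_trans xz.
  by apply: le_lt_trans ly; rewrite ler_wpM2l// sqrtr_ge0.
apply: (@deriv_pos_lt f
  (fun z => (cs k z * sn l z - sn k z * cs l z) / sn l z ^+ 2)) => // z xz zy.
  have [z0 lz] := ln z xz zy.
  have sl : sn l z != 0 by rewrite gt_eqF// sn_gt0.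
  have := @is_deriveV R (sn l) z 1 (cs l z) sl _ => hV.
  rewrite /f; eapply is_derive_eq; first typeclasses eauto.
  by rewrite /GRing.scale/=; field.
have [z0 lz] := ln z (ltW xz) (ltW zy).
by rewrite divr_gt0// ?exprn_gt0// ?sn_gt0// sn_wronskian_gt0// ltW.
Qed.

(** The derivatives of chord2 k and chord2 l have the increasing ratio
    sn k / sn l: chord2 k is a convex function of chord2 l, and sn k c / sn l c
    is its slope at c. *)
Lemma chord2_slope_lt k l v c : k < l -> 0 <= v -> v < c -> Num.sqrt l * c < pi ->
  chord2 k c - chord2 k v < sn k c / sn l c * (chord2 l c - chord2 l v).
Proof.
move=> kl v0 vc lc.
set M := sn k c / sn l c.
pose f z := M * chord2 l z - chord2 k z.
suff: f v < f c by rewrite /f; lra.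
apply: (@deriv_pos_lt f (fun z => 2 * (M * sn l z - sn k z))) => // z vz zc.
  rewrite /f; eapply is_derive_eq; first typeclasses eauto.
  by rewrite /GRing.scale/=; ring.
have z0 : 0 < z by apply: le_lt_trans vz.
have sl : 0 < sn l z.
  by apply: sn_gt0 => //; apply: le_lt_trans lc; rewrite ler_wpM2l ?sqrtr_ge0// ltW.
rewrite mulr_gt0// subr_gt0 -ltr_pdivrMr//.
exact: sn_ratio_lt.
Qed.

Lemma chord2_slope_le k l c u : k < l -> 0 < c -> c <= u ->
    Num.sqrt l * c < pi -> Num.sqrt l * u <= pi ->
  sn k c / sn l c * (chord2 l u - chord2 l c) <= chord2 k u - chord2 k c.
Proof.
move=> kl c0 cu lc lu.
set M := sn k c / sn l c.
pose f z := chord2 k z - M * chord2 l z.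
suff: f c <= f u by rewrite /f; lra.
apply: (@deriv_ge0_le f (fun z => 2 * (sn k z - M * sn l z))) => // z cz zu.
  rewrite /f; eapply is_derive_eq; first typeclasses eauto.
  by rewrite /GRing.scale/=; ring.
have lz := sqrtM_lt zu (pi_gt0 R) lu.
have sl : 0 < sn l z by apply: sn_gt0 => //; apply: lt_trans cz.
rewrite mulr_ge0// subr_ge0 -ler_pdivlMr//; apply/ltW.
exact: sn_ratio_lt.
Qed.

(** Jensen's inequality for the convex function that maps chord2 l to chord2 k. *)
Lemma chord2_mix_lt k l v c u : k < l -> 0 <= v -> v <= c -> c <= u -> v < u ->
    0 < c -> Num.sqrt l * (c + u) < 2 * pi ->
  chord2 l c <= 3 / 4 * chord2 l u + 1 / 4 * chord2 l v ->
  chord2 k c < 3 / 4 * chord2 k u + 1 / 4 * chord2 k v.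
Proof.
move=> kl v0 vc cu vu c0 lcu H.
have sl0 := sqrtr_ge0 l.
have lc : Num.sqrt l * c < pi.
  suff: Num.sqrt l * c <= Num.sqrt l * u by lra.
  by rewrite ler_wpM2l.
have kcu : Num.sqrt k * (c + u) < 2 * pi.
  by apply: sqrtM_mono_lt (ltW kl) _ lcu; lra.
move: vc; rewrite le_eqVlt => /orP[/eqP vc|vc].
  rewrite vc in vu *.
  rewrite (addrC c) in kcu; have := chord2_lt (ltW c0) vu kcu; lra.
have M0 : 0 < sn k c / sn l c.
  rewrite divr_gt0// sn_gt0//; exact: sqrtM_mono_lt (ltW kl) (ltW c0) lc.
have h1 := chord2_slope_lt kl v0 vc lc.
have h2 : sn k c / sn l c * (chord2 l u - chord2 l c) <= chord2 k u - chord2 k c.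
  have [lu|lu] := leP (Num.sqrt l * u) pi; first exact: chord2_slope_le.
  have l0 : 0 < Num.sqrt l.
    rewrite lt_neqAle sl0 andbT eq_sym; apply/eqP => l0.
    by move: lu; rewrite l0 mul0r; have := pi_gt0 R; lra.
  (* reflect u in pi / sqrt l: this keeps chord2 l and does not increase chord2 k *)
  pose w := 2 * pi / Num.sqrt l - u.
  have lw : Num.sqrt l * w = 2 * pi - Num.sqrt l * u.
    by rewrite /w mulrBr; congr (_ - _); field; rewrite gt_eqF.
  have cw : c <= w by rewrite -(ler_pM2l l0) lw; lra.
  have wu : w <= u by rewrite -(ler_pM2l l0) lw; lra.
  have sum : Num.sqrt l * ((u + w) / 2) = pi.
    by rewrite mulrA mulrDr lw; lra.
  have eqw : chord2 l u = chord2 l w.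
    apply/eqP; rewrite -subr_eq0 chord2B {1}/sn -sqrtr_gt0 l0 sum sinpi.
    by apply/eqP; ring.
  have lekw : chord2 k w <= chord2 k u.
    rewrite -subr_ge0 chord2B mulr_ge0// ?mulr_ge0//; apply: sn_ge0; try lra.
      by apply: (sqrtM_mono (ltW kl)); [lra|rewrite sum].
    apply: (sqrtM_mono (ltW kl)); first lra.
    by apply: (@sqrtM_le _ _ ((u + w) / 2)); [lra|rewrite sum].
  have : sn k c / sn l c * (chord2 l w - chord2 l c) <= chord2 k w - chord2 k c.
    by apply: chord2_slope_le => //; rewrite lw; lra.
  rewrite eqw; lra.
move: (sn k c / sn l c) M0 h1 h2 => M M0 h1 h2.
have : M * (chord2 l c - chord2 l v) <= M * (3 * (chord2 l u - chord2 l c)).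
  by rewrite ler_pM2l//; lra.
lra.
Qed.

End CurvatureComparison.

(** * Hinges *)

(** The squared chord of the third side of a hinge with legs p, q and angle
    arccos rho, by the law of cosines. *)
Definition hinge {R : realType} (k p q rho : R) : R := chord2 k p + chord2 k q
  - k / 2 * chord2 k p * chord2 k q - 2 * sn k p * sn k q * rho.

Local Notation hinge120 k p q := (hinge k p q (- 2^-1)).

Section LawOfCosines.
Set Implicit Arguments.
Unset Strict Implicit.
Context {R : realType}.
Implicit Types k l x y z p q s u v a c e rho : R.

Lemma hingeC k p q rho : hinge k p q rho = hinge k q p rho.
Proof. by rewrite /hinge; ring. Qed.

Lemma hingeE k p q rho :
  hinge k p q rho = chord2 k (p - q) + 2 * sn k p * sn k q * (1 - rho).
Proof. by rewrite chord2_sub /hinge; ring. Qed.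

(** At 120 degrees a hinge is the mean, with weights 3/4 and 1/4, of the two
    degenerate ones; this is what makes chord2_mix_lt applicable. *)
Lemma hinge120E k p q :
  hinge120 k p q = 3 / 4 * chord2 k (p + q) + 1 / 4 * chord2 k (p - q).
Proof. by rewrite chord2_sub chord2D /hinge; field. Qed.

(** Each term is nondecreasing in p as long as the legs are at most
    pi / (2 sqrt k). *)
Lemma hinge120_leg k p q :
  hinge120 k p q = chord2 k p * cs k q + chord2 k q + sn k p * sn k q.
Proof. by rewrite csE /hinge; field. Qed.

Lemma hinge_0l k q rho : hinge k 0 q rho = chord2 k q.
Proof. by rewrite /hinge chord20 sn0; ring. Qed.

Lemma hinge120_lt_curv k l p q c : k < l -> 0 < p -> 0 < q ->
    `|p - q| <= c -> c <= p + q -> 0 < c -> Num.sqrt l * (c + (p + q)) < 2 * pi ->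
  chord2 l c <= hinge120 l p q -> chord2 k c < hinge120 k p q.
Proof.
move=> kl p0 q0 pqc cpq c0 lcu; rewrite !hinge120E.
have E k' : chord2 k' (p - q) = chord2 k' `|p - q|.
  by case: (ger0P (p - q)) => _ //; rewrite chord2N.
rewrite !E; apply: chord2_mix_lt => //.
by rewrite ltr_norml; lra.
Qed.

Lemma pihalf_lt_pi : pi / 2 < pi :> R.
Proof. by have := pi_gt0 R; lra. Qed.

Lemma sn_quarter_ge0 k x : 0 <= x -> Num.sqrt k * x <= pi / 2 -> 0 <= sn k x.
Proof. by move=> x0 h; apply: sn_ge0 => //; have := pihalf_lt_pi; lra. Qed.

Lemma sn_quarter_gt0 k x : 0 < x -> Num.sqrt k * x <= pi / 2 -> 0 < sn k x.
Proof. by move=> x0 h; apply: sn_gt0 => //; have := pihalf_lt_pi; lra. Qed.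

Lemma sn_quarter_le k x y : 0 <= x -> x <= y -> Num.sqrt k * y <= pi / 2 ->
  sn k x <= sn k y.
Proof.
move=> x0 xy ky.
apply: (@deriv_ge0_le _ (sn k) (cs k)) => // z xz zy.
by apply: cs_ge0; [lra|apply: sqrtM_le ky; lra].
Qed.

Lemma sn_quarter_lt k x y : 0 <= x -> x < y -> Num.sqrt k * y <= pi / 2 ->
  sn k x < sn k y.
Proof.
move=> x0 xy ky.
apply: (@deriv_pos_lt _ (sn k) (cs k)) => // z xz zy.
apply: cs_gt0; first lra.
by apply: sqrtM_lt zy _ ky; have := pi_gt0 R; lra.
Qed.

Lemma hinge120_le_leg k p p' q : 0 <= p -> p <= p' -> 0 <= q ->
  Num.sqrt k * p' <= pi / 2 -> Num.sqrt k * q <= pi / 2 ->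
  hinge120 k p q <= hinge120 k p' q.
Proof.
move=> p0 pp' q0 kp' kq; rewrite !hinge120_leg lerD// ?lerD//.
  rewrite ler_wpM2r// ?cs_ge0// chord2_leD//.
  by have := pihalf_lt_pi; lra.
by rewrite ler_wpM2r// ?sn_quarter_ge0// sn_quarter_le.
Qed.

Lemma hinge120_lt_leg k p p' q : 0 <= p -> p < p' -> 0 <= q ->
  Num.sqrt k * p' <= pi / 2 -> Num.sqrt k * q <= pi / 2 ->
  hinge120 k p q < hinge120 k p' q.
Proof.
move=> p0 pp' q0 kp' kq; rewrite !hinge120_leg.
have c1 : chord2 k p < chord2 k p'.
  by rewrite chord2_ltD//; have := pihalf_lt_pi; lra.
have s1 : sn k p < sn k p' by rewrite sn_quarter_lt.
have [->|qn] := eqVneq q 0; first by rewrite cs0 sn0; lra.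
have q0' : 0 < q by rewrite lt_neqAle eq_sym qn.
have sq := sn_quarter_gt0 q0' kq.
have c2 : chord2 k p * cs k q <= chord2 k p' * cs k q.
  by rewrite ler_wpM2r ?cs_ge0// ltW.
have : sn k p * sn k q < sn k p' * sn k q by rewrite ltr_pM2r.
lra.
Qed.

(** The derivative along this exchange is 3 sn (p + 2 z) cs (q - z). *)
Lemma hinge120_exchange_lt k p q e : 0 <= p -> 0 < e -> e <= q ->
    Num.sqrt k * (p + 2 * e) <= pi / 2 -> Num.sqrt k * q <= pi / 2 ->
  hinge120 k p q < hinge120 k (p + 2 * e) (q - e).
Proof.
move=> p0 e0 eq kp kq; rewrite !hinge120E.
pose f z := 3 / 4 * chord2 k (p + q + z) + 1 / 4 * chord2 k (p - q + 3 * z).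
have -> : 3 / 4 * chord2 k (p + q) + 1 / 4 * chord2 k (p - q) = f 0.
  by rewrite /f mulr0 !addr0.
have -> : 3 / 4 * chord2 k (p + 2 * e + (q - e))
    + 1 / 4 * chord2 k (p + 2 * e - (q - e)) = f e.
  by rewrite /f; congr (_ * chord2 k _ + _ * chord2 k _); ring.
apply: (@deriv_pos_lt _ f (fun z => 3 * (sn k (p + 2 * z) * cs k (q - z)))) => //.
  move=> z _ _; rewrite /f; eapply is_derive_eq; first typeclasses eauto.
  have := snD k (p + 2 * z) (q - z); have := snB k (p + 2 * z) (q - z).
  rewrite (_ : p + 2 * z - (q - z) = p - q + 3 * z); last by ring.
  rewrite (_ : p + 2 * z + (q - z) = p + q + z); last by ring.
  by move=> -> ->; rewrite /GRing.scale/=; field.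
move=> z z0 ze; rewrite !mulr_gt0//.
  apply: sn_quarter_gt0; first lra.
  by apply: sqrtM_le kp; lra.
apply: cs_gt0; first lra.
by apply: sqrtM_lt _ _ kq; [lra|have := pi_gt0 R; lra].
Qed.

End LawOfCosines.

(** * The metric tensor of a model surface *)

Section ModelSurface.
Set Implicit Arguments.
Unset Strict Implicit.
Context {R : realType}.
Implicit Types (k l p q s t a c e rho : R) (x y z u v w P X Y Z : R * R * R).

Definition lin2 a x c y : R * R * R :=
  (a * x.1.1 + c * y.1.1, a * x.1.2 + c * y.1.2, a * x.2 + c * y.2).

(** The metric tensor in ambient coordinates.  The division by k undoes the
    rescaling of the surface, and turns the sign of model_form on the tangent
    planes of the hyperboloid; for k = 0 the first coordinate is constant. *)
Definition bform k v w : R :=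
  if k == 0 then v.1.2 * w.1.2 + v.2 * w.2 else model_form k v w / k.

Definition tproj k P X := lin2 1 X (- model_form k X P) P.

(** The inner product of the initial directions of the segments from P to X and
    to Y, each scaled by sn of its length. *)
Definition tform k P X Y := bform k (tproj k P X) (tproj k P Y).

Lemma model_formC k x y : model_form k x y = model_form k y x.
Proof.
by case: x => [[x0 x1] x2]; case: y => [[y0 y1] y2]; rewrite /model_form/=; ring.
Qed.

Lemma model_form_lin k a x c y z :
  model_form k (lin2 a x c y) z = a * model_form k x z + c * model_form k y z.
Proof.
case: x => [[x0 x1] x2]; case: y => [[y0 y1] y2]; case: z => [[z0 z1] z2].
by rewrite /model_form/=; ring.
Qed.

Lemma bformC k x y : bform k x y = bform k y x.
Proof. by rewrite /bform model_formC; case: ifP => // _; ring. Qed.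

Lemma bform_lin k a x c y z :
  bform k (lin2 a x c y) z = a * bform k x z + c * bform k y z.
Proof.
rewrite /bform; case: ifP => [_|/negbT k0]; first by rewrite /=; ring.
by rewrite model_form_lin; field.
Qed.

Lemma tproj_lin k P a x c y :
  tproj k P (lin2 a x c y) = lin2 a (tproj k P x) c (tproj k P y).
Proof.
rewrite /tproj model_form_lin /lin2/=.
by congr (_, _, _); ring.
Qed.

Lemma tformC k P x y : tform k P x y = tform k P y x.
Proof. exact: bformC. Qed.

Lemma tform_lin k P a x c y z :
  tform k P (lin2 a x c y) z = a * tform k P x z + c * tform k P y z.
Proof. by rewrite /tform tproj_lin bform_lin. Qed.

Lemma model_form0 x y : model_form 0 x y = x.1.1 * y.1.1.
Proof.
case: x => [[x0 x1] x2]; case: y => [[y0 y1] y2].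
by rewrite /model_form/= sgr0; ring.
Qed.

Lemma model0 x : model_space 0 x -> x.1.1 = 1.
Proof.
move=> [+ /(_ (lexx _)) x0]; rewrite model_form0 => h.
have : (x.1.1 - 1) * (x.1.1 + 1) = 0 by move: h; lra.
by move=> /eqP; rewrite mulf_eq0 => /orP[]/eqP; lra.
Qed.

Lemma tproj_orth k P x : model_space k P -> model_form k (tproj k P x) P = 0.
Proof. by move=> [PP _]; rewrite /tproj model_form_lin PP; ring. Qed.

Lemma tform_self k P y : model_space k P -> tform k P P y = 0.
Proof.
move=> [PP _]; rewrite /tform /tproj bform_lin PP; ring.
Qed.

Lemma tformE k P x y : model_space k P -> k != 0 ->
  tform k P x y = (model_form k x y - model_form k x P * model_form k y P) / k.
Proof.
move=> mP k0; rewrite /tform {1}/tproj bform_lin /bform (negbTE k0).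
rewrite (model_formC _ P) tproj_orth// (model_formC _ x) /tproj model_form_lin.
rewrite (model_formC k P x) (model_formC k y x); field. exact: k0.
Qed.

Lemma tform0E P x y : model_space 0 P -> model_space 0 x -> model_space 0 y ->
  tform 0 P x y = (x.1.2 - P.1.2) * (y.1.2 - P.1.2) + (x.2 - P.2) * (y.2 - P.2).
Proof.
move=> /model0 P0 /model0 x0 /model0 y0.
by rewrite /tform /bform eqxx /tproj !model_form0 /= P0 x0 y0; ring.
Qed.

(** The metric tensor is positive definite.  On the hyperboloid this is the
    reversed Cauchy-Schwarz inequality, in the form of the identity
    P0^2 (v1^2 + v2^2 - v0^2) = v1^2 + v2^2 + (v1 P2 - v2 P1)^2 for v orthogonal
    to P. *)
Lemma bform_tangent k P v : model_space k P -> model_form k v P = 0 ->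
  0 <= bform k v v /\ (bform k v v = 0 -> v = (0, 0, 0)).
Proof.
case: P => [[P0 P1] P2]; case: v => [[v0 v1] v2].
rewrite /bform /model_space /model_form/= => -[PP Ppos] vP.
have sq0 (a b c : R) : a ^+ 2 + b ^+ 2 + c ^+ 2 = 0 -> [/\ a = 0, b = 0 & c = 0].
  move=> h; have := sqr_ge0 a; have := sqr_ge0 b; have := sqr_ge0 c => hc hb ha.
  by split; apply/eqP; rewrite -sqrf_eq0; apply/eqP; lra.
case: (ltrgt0P k) Ppos PP vP => [k0 _|k0 Ppos|-> Ppos].
- rewrite (gtr0_sg k0) => PP vP; split.
    apply: divr_ge0; last exact: ltW.
    by have := (sqr_ge0 v0, sqr_ge0 v1, sqr_ge0 v2) => -[[]]; lra.
  move=> /eqP; rewrite mulf_eq0 invr_eq0 (gt_eqF k0) orbF => /eqP h.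
  by have [|-> -> ->] := sq0 v0 v1 v2; first by lra.
- rewrite (ltr0_sg k0) => PP vP.
  have {}Ppos := Ppos isT.
  have h : P0 ^+ 2 * (v1 ^+ 2 + v2 ^+ 2 - v0 ^+ 2) =
      v1 ^+ 2 + v2 ^+ 2 + (v1 * P2 - v2 * P1) ^+ 2.
    have e0 : v0 * P0 = v1 * P1 + v2 * P2 by lra.
    have -> : P0 ^+ 2 * (v1 ^+ 2 + v2 ^+ 2 - v0 ^+ 2) =
      P0 ^+ 2 * (v1 ^+ 2 + v2 ^+ 2) - (v0 * P0) ^+ 2 by ring.
    have -> : P0 ^+ 2 = 1 + P1 ^+ 2 + P2 ^+ 2 by move: PP; lra.
    by rewrite e0; ring.
  have E : (v0 * v0 + -1 * (v1 * v1 + v2 * v2)) / k =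
      (v1 ^+ 2 + v2 ^+ 2 + (v1 * P2 - v2 * P1) ^+ 2) / (P0 ^+ 2 * - k).
    by rewrite -h; field; rewrite ?(lt_eqF k0) ?(gt_eqF Ppos).
  have d0 : 0 < P0 ^+ 2 * - k by rewrite mulr_gt0 ?exprn_gt0//; lra.
  rewrite E; split.
    by rewrite divr_ge0 ?(ltW d0)// addr_ge0 ?addr_ge0 ?sqr_ge0.
  move=> /eqP; rewrite mulf_eq0 invr_eq0 (gt_eqF d0) orbF => /eqP.
  move=> /sq0[h1 h2 h3].
  have : v0 * P0 = 0 by rewrite h1 h2 in vP; lra.
  by move=> /eqP; rewrite mulf_eq0 (gt_eqF Ppos) orbF => /eqP ->; rewrite h1 h2.
- rewrite sgr0 => PP vP; have {}Ppos := Ppos isT.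
  split; first by rewrite -!expr2 addr_ge0 ?sqr_ge0.
  move=> h.
  have := sqr_ge0 v1; have := sqr_ge0 v2 => a b.
  have : v0 * P0 = 0 by lra.
  move=> /eqP; rewrite mulf_eq0 (gt_eqF Ppos) orbF => /eqP ->.
  by congr (_, _, _); apply/eqP; rewrite -sqrf_eq0; apply/eqP; lra.
Qed.

Lemma tform_ge0 k P x : model_space k P -> 0 <= tform k P x x.
Proof. by move=> mP; have [] := bform_tangent mP (tproj_orth x mP). Qed.

Lemma tform_eq0 k P x : model_space k P -> tform k P x x = 0 ->
  x = lin2 (model_form k x P) P 0 P.
Proof.
move=> mP; have [_ h /h] := bform_tangent mP (tproj_orth x mP).
rewrite /tproj /lin2; case: x {h} => [[x0 x1] x2] [] /= h0 h1 h2.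
by congr (_, _, _); lra.
Qed.

Lemma tform_CS k P x y : model_space k P ->
  tform k P x y ^+ 2 <= tform k P x x * tform k P y y.
Proof.
move=> mP.
have h a c : 0 <= a ^+ 2 * tform k P x x + 2 * a * c * tform k P x y
    + c ^+ 2 * tform k P y y.
  have := tform_ge0 (lin2 a x c y) mP.
  rewrite tform_lin 2!(tformC k P _ (lin2 _ _ _ _)) !tform_lin.
  by rewrite (tformC k P y x); lra.
have := tform_ge0 x mP; have := tform_ge0 y mP.
move: (tform k P x x) (tform k P y y) (tform k P x y) h => A B C h B0 A0.
have [Az|An] := eqVneq A 0.
  have [->|Cn] := eqVneq C 0; first by rewrite Az expr0n/=; lra.
  have := h (- (B + 1) / C) 1.
  rewrite (_ : 2 * (- (B + 1) / C) * 1 * C = - 2 * (B + 1)); last by field.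
  by rewrite Az => h'; exfalso; lra.
have A0' : 0 < A by rewrite lt_neqAle eq_sym An.
have := h (- C) A => h1.
have : 0 <= A * (A * B - C ^+ 2) by lra.
by rewrite pmulr_rge0//; lra.
Qed.

End ModelSurface.

(** * The distance of a model surface *)

Section ModelDistance.
Set Implicit Arguments.
Unset Strict Implicit.
Context {R : realType}.
Implicit Types (k l p q r s t a c e rho : R) (x y z u v w P X Y Z : R * R * R).

Lemma sn_flat s : sn 0 s = s. Proof. by rewrite /sn ltxx. Qed.

Lemma cs_flat s : cs 0 s = 1. Proof. by rewrite /cs ltxx. Qed.

Lemma chord2_flat s : chord2 0 s = s ^+ 2.
Proof. by rewrite /chord2 sn_flat; field. Qed.

Lemma cosh_arcosh s : 1 <= s -> cosh (arcosh s) = s.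
Proof.
move=> s1; have h : 0 <= s ^+ 2 - 1 by rewrite subr_ge0 expr_ge1//; lra.
have q2 := sqr_sqrtr h; have q0 := sqrtr_ge0 (s ^+ 2 - 1).
have u0 : 0 < s + Num.sqrt (s ^+ 2 - 1) by lra.
rewrite /cosh /arcosh expRN lnK ?posrE//.
have -> : (s + Num.sqrt (s ^+ 2 - 1))^-1 = s - Num.sqrt (s ^+ 2 - 1).
  apply: (mulfI (lt0r_neq0 u0)); rewrite divff ?lt0r_neq0//.
  move: q2; set q := Num.sqrt _ => q2; lra.
by field.
Qed.

Lemma arcosh_ge0 s : 1 <= s -> 0 <= arcosh s.
Proof.
by move=> s1; rewrite ln_ge0//; have := sqrtr_ge0 (s ^+ 2 - 1); lra.
Qed.

Lemma model_form_spherical k x y : 0 < k -> model_space k x -> model_space k y ->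
  -1 <= model_form k x y <= 1.
Proof.
move=> k0 mx my; have := tform_ge0 y mx.
rewrite tformE ?gt_eqF// (proj1 my) (model_formC k y x).
rewrite pmulr_lge0 ?invr_gt0// subr_ge0 -expr2 => h.
by rewrite -ler_norml -ler_sqr ?nnegrE// real_normK ?num_real// expr1n.
Qed.

Lemma model_form_hyperbolic k x y : k < 0 -> model_space k x -> model_space k y ->
  1 <= model_form k x y.
Proof.
move=> k0 mx my; have := tform_ge0 y mx.
rewrite tformE ?lt_eqF// (proj1 my) (model_formC k y x).
rewrite nmulr_lge0 ?invr_lt0// subr_le0 -expr2.
have : 0 < model_form k x y.
  case: x y mx my => [[x0 x1] x2] [[y0 y1] y2].
  rewrite /model_space /model_form/= (ltr0_sg k0) (ltW k0).
  move=> [xx /(_ isT) x0p] [yy /(_ isT) y0p].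
  have h : (x1 * y1 + x2 * y2) ^+ 2 <= (x1 ^+ 2 + x2 ^+ 2) * (y1 ^+ 2 + y2 ^+ 2).
    by have := sqr_ge0 (x1 * y2 - x2 * y1); lra.
  have hx : x1 ^+ 2 + x2 ^+ 2 = x0 ^+ 2 - 1 by lra.
  have hy : y1 ^+ 2 + y2 ^+ 2 = y0 ^+ 2 - 1 by lra.
  rewrite hx hy in h.
  have xy : 0 < x0 * y0 by rewrite mulr_gt0.
  have {}h : (x1 * y1 + x2 * y2) ^+ 2 < (x0 * y0) ^+ 2.
    have := sqr_ge0 x1; have := sqr_ge0 x2.
    have := sqr_ge0 y1; have := sqr_ge0 y2.
    by lra.
  suff: x1 * y1 + x2 * y2 < x0 * y0 by lra.
  apply: le_lt_trans (ler_norm _) _.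
  by rewrite -(ger0_norm (ltW xy)) -ltr_sqr ?nnegrE// !real_normK ?num_real.
by move=> f0 h; rewrite -ler_sqr ?nnegrE ?(ltW f0) ?ler01 ?expr1n.
Qed.

Lemma model_dist_ge0 k x y : model_space k x -> model_space k y ->
  0 <= model_dist k x y.
Proof.
move=> mx my; rewrite /model_dist; case: (ltrgt0P k) => k0.
- by rewrite divr_ge0 ?sqrtr_ge0// acos_ge0// model_form_spherical.
- by rewrite divr_ge0 ?sqrtr_ge0// arcosh_ge0// model_form_hyperbolic.
- exact: sqrtr_ge0.
Qed.

Lemma model_dist_le k x y : model_space k x -> model_space k y ->
  Num.sqrt k * model_dist k x y <= pi.
Proof.
move=> mx my; have [k0|k0] := leP k 0.
  by rewrite sqrt_npos// mul0r pi_ge0.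
rewrite /model_dist k0 mulrC divfK ?sqrt_neq0//.
by rewrite acos_lepi// model_form_spherical.
Qed.

Lemma cs_model_dist k x y : model_space k x -> model_space k y ->
  cs k (model_dist k x y) = model_form k x y.
Proof.
move=> mx my; rewrite /model_dist /cs; case: (ltrgt0P k) => k0.
- rewrite mulrC divfK ?sqrt_neq0// acosK// in_itv/=.
  exact: model_form_spherical.
- rewrite mulrC divfK ?sqrt_neq0 ?oppr_gt0// cosh_arcosh//.
  exact: model_form_hyperbolic.
- by rewrite k0 in mx my *; rewrite model_form0 !model0// mulr1.
Qed.

(** The law of cosines at P, in a form common to the three geometries. *)
Lemma chord2_model_dist k P x y :
    model_space k P -> model_space k x -> model_space k y ->
  chord2 k (model_dist k x y) =
    chord2 k (model_dist k P x) + chord2 k (model_dist k P y)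
    - k / 2 * chord2 k (model_dist k P x) * chord2 k (model_dist k P y)
    - 2 * tform k P x y.
Proof.
move=> mP mx my; have [k0|k0] := eqVneq k 0.
  rewrite k0 in mP mx my *; rewrite tform0E// /chord2 /sn /model_dist ltxx.
  rewrite !model0// subrr expr0n/= !add0r !exprMn !sqr_sqrtr ?addr_ge0 ?sqr_ge0//.
  by field.
have h z w : model_space k z -> model_space k w ->
    chord2 k (model_dist k z w) = 2 / k * (1 - model_form k z w).
  by move=> mz mw; rewrite -cs_model_dist// csE; field.
rewrite !h// tformE// (model_formC k x P) (model_formC k y P).
by field.
Qed.

Lemma model_distC k x y : model_dist k x y = model_dist k y x.
Proof.
rewrite /model_dist model_formC; case: ifP => //_; case: ifP => // _.
by congr Num.sqrt; ring.
Qed.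

Lemma model_distxx k x : model_space k x -> model_dist k x x = 0.
Proof.
move=> mx; rewrite /model_dist (proj1 mx); case: ifP => _; first by rewrite acos1 mul0r.
case: ifP => _; last by rewrite !subrr expr0n/= !addr0 sqrtr0.
by rewrite /arcosh expr1n subrr sqrtr0 addr0 ln1 mul0r.
Qed.

Lemma tform_sn k P x : model_space k P -> model_space k x ->
  tform k P x x = sn k (model_dist k P x) ^+ 2.
Proof.
move=> mP mx; have := chord2_model_dist mP mx mx.
rewrite model_distxx// chord20 sn2E; lra.
Qed.

Lemma sn_model_dist_ge0 k x y : model_space k x -> model_space k y ->
  0 <= sn k (model_dist k x y).
Proof. by move=> mx my; rewrite sn_ge0 ?model_dist_ge0 ?model_dist_le. Qed.

Lemma tform_le k P x y : model_space k P -> model_space k x -> model_space k y ->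
  `|tform k P x y| <= sn k (model_dist k P x) * sn k (model_dist k P y).
Proof.
move=> mP mx my; have := tform_CS x y mP; rewrite !tform_sn// -exprMn.
rewrite -(real_normK (num_real (tform k P x y))) ler_sqr// .
by rewrite nnegrE mulr_ge0 ?sn_model_dist_ge0.
Qed.

Lemma model_dist_triangle k x P y :
    model_space k P -> model_space k x -> model_space k y ->
  model_dist k x y <= model_dist k x P + model_dist k P y.
Proof.
move=> mP mx my; rewrite (model_distC k x P).
set p := model_dist k P x; set q := model_dist k P y.
have [h|h] := leP (Num.sqrt k * (p + q)) pi; last first.
  have := model_dist_le mx my; have := sqrtr_ge0 k.
  move=> + h'; rewrite le_eqVlt => /orP[/eqP k0|k0].
    by move: h; rewrite -k0 mul0r; have := pi_gt0 R; lra.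
  by apply/ltW; rewrite -(ltr_pM2l k0); lra.
apply: (@le_of_chord2 _ k); rewrite ?addr_ge0 ?model_dist_ge0 ?model_dist_le//.
rewrite (chord2_model_dist mP mx my) chord2D -/p -/q.
have := tform_le mP mx my; rewrite -/p -/q ler_norml; lra.
Qed.

Lemma dist_of_chord2 k x y d : model_space k x -> model_space k y ->
    0 <= d -> Num.sqrt k * d <= pi -> chord2 k (model_dist k x y) = chord2 k d ->
  model_dist k x y = d.
Proof.
move=> mx my d0 kd E.
apply/eqP; rewrite eq_le; apply/andP; split; apply: (@le_of_chord2 _ k) => //.
- exact: model_dist_le.
- by rewrite E.
- exact: model_dist_ge0.
- by rewrite E.
Qed.

Lemma model_dist_eq0 k x y : model_space k x -> model_space k y ->
  model_dist k x y = 0 -> x = y.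
Proof.
move=> mx my d0; have := tform_sn mx my; rewrite d0 sn0 expr0n => /(tform_eq0 mx).
rewrite model_formC -cs_model_dist// d0 cs0 => ->.
by case: x {mx d0} => [[x0 x1] x2]; rewrite /lin2/= !mul1r !mul0r !addr0.
Qed.

(** The ratio between lengths in R^3 and distances in the surface. *)
Definition mscale k : R := if k == 0 then 1 else Num.sqrt `|k|.

(** The point at distance r from (1, 0, 0) in the direction (c, e), which is
    meant to be a unit vector, the cosine and sine of the polar angle. *)
Definition polar k r c e : R * R * R :=
  (cs k r, mscale k * sn k r * c, mscale k * sn k r * e).

Lemma mscale2 k : k != 0 -> Num.sg k * mscale k ^+ 2 = k.
Proof.
by move=> k0; rewrite /mscale (negbTE k0) sqr_sqrtr// -numEsg.
Qed.

Lemma form_polar k r c e r' c' e' :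
  model_form k (polar k r c e) (polar k r' c' e') =
  cs k r * cs k r' + k * sn k r * sn k r' * (c * c' + e * e').
Proof.
have [->|k0] := eqVneq k 0; first by rewrite model_form0 /=; ring.
transitivity (cs k r * cs k r' +
  (Num.sg k * mscale k ^+ 2) * sn k r * sn k r' * (c * c' + e * e')).
  by rewrite /model_form/=; ring.
by rewrite mscale2.
Qed.

Lemma polar_model k r c e : c ^+ 2 + e ^+ 2 = 1 -> model_space k (polar k r c e).
Proof.
move=> ce; split.
  rewrite form_polar -!expr2 ce.
  by have := csDksn k r; lra.
by move=> k0 /=; rewrite /cs; case: (ltrgt0P k) k0 => // _ _; exact: cosh_gt0.
Qed.

Lemma chord2_polar k r c e r' c' e' :
    c ^+ 2 + e ^+ 2 = 1 -> c' ^+ 2 + e' ^+ 2 = 1 ->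
  chord2 k (model_dist k (polar k r c e) (polar k r' c' e')) =
  hinge k r r' (c * c' + e * e').
Proof.
move=> h h'; have m := polar_model k r h; have m' := polar_model k r' h'.
have [k0|k0] := eqVneq k 0.
  rewrite k0 /hinge !chord2_flat !sn_flat /model_dist ltxx /polar/=.
  rewrite !sn_flat !cs_flat /mscale eqxx subrr expr0n/= add0r !mul1r.
  rewrite sqr_sqrtr ?addr_ge0 ?sqr_ge0//.
  rewrite (_ : (r * c - r' * c') ^+ 2 + (r * e - r' * e') ^+ 2 =
    r ^+ 2 * (c ^+ 2 + e ^+ 2) + r' ^+ 2 * (c' ^+ 2 + e' ^+ 2)
    - 2 * r * r' * (c * c' + e * e')); last by ring.
  by rewrite h h'; field.
have := cs_model_dist m m'; rewrite form_polar !csE /hinge.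
move: (chord2 k (model_dist _ _ _)) => T E.
have -> : T = 2 / k * (1 - (1 - k / 2 * T)) by field.
by rewrite E; field.
Qed.

Lemma model_dist_polar k r c e r' c' e' d :
    c ^+ 2 + e ^+ 2 = 1 -> c' ^+ 2 + e' ^+ 2 = 1 ->
    0 <= d -> Num.sqrt k * d <= pi -> chord2 k d = hinge k r r' (c * c' + e * e') ->
  model_dist k (polar k r c e) (polar k r' c' e') = d.
Proof.
move=> h h' d0 kd E; apply: dist_of_chord2 => //.
- exact: polar_model.
- exact: polar_model.
- by rewrite chord2_polar// E.
Qed.

End ModelDistance.

(** * First variation and convexity in a model surface *)

Section FirstVariation.
Set Implicit Arguments.
Unset Strict Implicit.
Context {R : realType}.
Implicit Types (k l p q r s t a c e rho tau : R) (x y P Q : R * R * R).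

(** Both sides agree at s = 0, where their derivatives are -2 rho sn p and
    -2 tau sn p: along a segment that makes the angle arccos rho with a leg of
    length p, this leg shrinks at a rate at least tau. *)
Lemma first_variation k p tau rho : 0 < p -> Num.sqrt k * p < pi -> tau < rho ->
  \forall s \near 0^'+, hinge k p s rho < chord2 k (p - tau * s).
Proof.
move=> p0 kp tr.
pose df s := 2 * (sn k s * (k / 2 * chord2 k p - 1) + sn k p * cs k s * rho
  - tau * sn k (p - tau * s)).
have df0 : 0 < df 0.
  rewrite /df sn0 cs0 mulr0 subr0; have := sn_gt0 p0 kp => h.
  have : sn k p * tau < sn k p * rho by rewrite ltr_pM2l.
  lra.
have cdf : {for 0, continuous df}.
  apply/differentiable_continuous/derivable1_diffP; exact: ex_derive.
have : \forall s \near 0, 0 < df s by exact: (cvgr_gt (df 0) cdf).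
move=> /nbhs_ballP[d /= d0 h].
near=> s.
have s0 : 0 < s by [].
have sd : s < d by near: s; exact: nbhs_right_lt.
pose f z := chord2 k (p - tau * z) - hinge k p z rho.
suff : f 0 < f s.
  by rewrite /f hingeC hinge_0l mulr0 subr0; lra.
apply: (@deriv_pos_lt _ f df) => // z z0 zs.
  rewrite /f /hinge; eapply is_derive_eq; first typeclasses eauto.
  by rewrite /GRing.scale/= /df; field.
by apply: h; rewrite /ball/= sub0r normrN ger0_norm ?ltW//; lra.
Unshelve. all: by end_near. Qed.

Lemma sn_cs_chord2 k s t : sn k s = sn k t -> cs k s = cs k t ->
  chord2 k s = chord2 k t.
Proof.
have [->|k0] := eqVneq k 0; first by rewrite !sn_flat => ->.
rewrite !csE => _ h; have {}h : k / 2 * (chord2 k s - chord2 k t) = 0 by lra.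
apply/eqP; rewrite -subr_eq0; move: h => /eqP; rewrite mulf_eq0 mulf_eq0 invr_eq0.
by rewrite (negbTE k0) pnatr_eq0.
Qed.

End FirstVariation.

Section Cone.
Set Implicit Arguments.
Unset Strict Implicit.
Context {R : realType}.
Implicit Types (k l p q r s t a b c e rho tau : R) (x y z u v w P A B C D Q : R * R * R).

Lemma sn_lin2 k a b x y z : model_space k x -> model_space k y -> model_space k z ->
    0 <= b -> z = lin2 a x b y ->
  sn k (model_dist k x z) = b * sn k (model_dist k x y).
Proof.
move=> mx my mz b0 zE; apply/eqP.
rewrite -(@eqrXn2 _ 2) ?sn_model_dist_ge0 ?mulr_ge0 ?sn_model_dist_ge0//.
rewrite -tform_sn// zE tform_lin tform_self// tformC tform_lin tform_self//.
by rewrite tform_sn//; apply/eqP; ring.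
Qed.

Lemma cs_lin2 k a b x y z : model_space k x -> model_space k y -> model_space k z ->
  z = lin2 a x b y ->
  cs k (model_dist k x z) = a + b * cs k (model_dist k x y).
Proof.
move=> mx my mz zE; rewrite !cs_model_dist// zE model_formC model_form_lin.
by rewrite (proj1 mx) mulr1 (model_formC k y).
Qed.

Lemma form_lin2_self k a b x y : model_space k x -> model_space k y ->
  model_form k (lin2 a x b y) (lin2 a x b y) =
  a ^+ 2 + b ^+ 2 + 2 * a * b * cs k (model_dist k x y).
Proof.
move=> mx my; rewrite model_form_lin !(model_formC k _ (lin2 _ _ _ _)).
rewrite !model_form_lin (proj1 mx) (proj1 my) (model_formC k y x).
by rewrite cs_model_dist//; ring.
Qed.

(** With s, s', t the distances x z, z y, x y, the coordinates of z give
    sn s = b sn t, sn s' = a sn t and the corresponding cosines, whence sn and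
    cs agree at s + s' and at t. *)
Lemma segment_of_cone k a b x y z :
    model_space k x -> model_space k y -> model_space k z ->
    0 <= a -> 0 <= b -> z = lin2 a x b y ->
  model_segment k x y z.
Proof.
move=> mx my mz a0 b0 zE; split=> //.
have zE' : z = lin2 b y a x by rewrite zE /lin2; congr (_, _, _); ring.
have s1 := sn_lin2 mx my mz b0 zE; have c1 := cs_lin2 mx my mz zE.
have s2 := sn_lin2 my mx mz a0 zE'; have c2 := cs_lin2 my mx mz zE'.
rewrite (model_distC k y x) (model_distC k y z) in s2 c2.
have unit_z : a ^+ 2 + b ^+ 2 + 2 * a * b * cs k (model_dist k x y) = 1.
  by have := proj1 mz; rewrite zE form_lin2_self.
have tri := model_dist_triangle mz mx my.
have hs := model_dist_le mx mz; have hs' := model_dist_le mz my.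
have ht := model_dist_ge0 mx my; have k0 := sqrtr_ge0 k.
move: (model_dist k x z) (model_dist k z y) (model_dist k x y)
  s1 c1 s2 c2 unit_z tri hs hs' ht => s s' t s1 c1 s2 c2 unit_z tri hs hs' ht.
have pyth := csDksn k t.
have eqs : sn k (s + s') = sn k t.
  rewrite snD s1 c1 s2 c2 -[RHS]mul1r -unit_z; ring.
have eqc : cs k (s + s') = cs k t.
  have ksn : k * sn k t ^+ 2 = 1 - cs k t ^+ 2 by lra.
  rewrite csD s1 c1 s2 c2.
  have -> : k * (b * sn k t * (a * sn k t)) = a * b * (k * sn k t ^+ 2) by ring.
  rewrite ksn; transitivity
    (cs k t * (a ^+ 2 + b ^+ 2 + 2 * a * b * cs k t)); first by ring.
  by rewrite unit_z mulr1.
have : chord2 k (s + s' - t) = 0.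
  rewrite -(chord20 k); apply: sn_cs_chord2.
    by rewrite snB eqs eqc sn0; ring.
  by rewrite csB eqs eqc cs0; lra.
move=> /eqP; rewrite mulf_eq0 pnatr_eq0 /= sqrf_eq0 => /eqP h.
apply/eqP; rewrite eq_le tri andbT leNgt; apply/negP => lt.
have pi0 := pi_gt0 R.
have kt : 0 <= Num.sqrt k * t by rewrite mulr_ge0.
have [h1|h1] := ltP (Num.sqrt k * ((s + s' - t) / 2)) pi.
  have hp : 0 < sn k ((s + s' - t) / 2) by apply: sn_gt0 => //; lra.
  by rewrite h ltxx in hp.
(* the other possibility is x = y antipodal to z, where a + b = -1 *)
have kt0 : Num.sqrt k * t = 0 by lra.
have ks : Num.sqrt k * s = pi by lra.
have kpos : 0 < k.
  by rewrite -sqrtr_gt0 lt_neqAle k0 andbT eq_sym; apply/eqP => e; rewrite e mul0r in ks; lra.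
move: c1; rewrite /cs kpos kt0 ks cos0 cospi; lra.
Qed.

Lemma lin2_solve a b x y z :
  lin2 1 z (- b) y = lin2 a x 0 x -> z = lin2 a x b y.
Proof.
case: z => [[z0 z1] z2]; rewrite /lin2/= => -[h0 h1 h2].
by congr (_, _, _); lra.
Qed.

(** Equality in the triangle inequality makes the law of cosines at x
    degenerate: the tangential part of z is m times that of y, with
    m = sn s / sn t. *)
Lemma cone_of_segment k x y z : model_space k x -> model_space k y ->
    Num.sqrt k * model_dist k x y < pi -> model_segment k x y z ->
  exists a b, [/\ 0 <= a, 0 <= b & z = lin2 a x b y].
Proof.
move=> mx my kt [mz E].
have s0 := model_dist_ge0 mx mz; have s'0 := model_dist_ge0 mz my.
set t := model_dist k x y in E kt *; set s := model_dist k x z in E s0.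
have [t0|tn] := eqVneq t 0.
  exists 1, 0; split => //.
  have : model_dist k x z = 0 by rewrite -/s; lra.
  move/(model_dist_eq0 mx mz) => <-; case: x {mx t E kt s s0 t0} => [[a b] c].
  by rewrite /lin2/= !mul1r !mul0r !addr0.
have t0 : 0 < t by rewrite lt_neqAle eq_sym tn model_dist_ge0.
have snt : 0 < sn k t by apply: sn_gt0.
have T : tform k x z y = sn k s * sn k t.
  have := chord2_model_dist mx mz my; rewrite -/s -/t.
  rewrite (_ : model_dist k z y = t - s); last lra.
  by rewrite chord2_sub; lra.
set m := sn k s / sn k t.
pose v := lin2 1 z (- m) y.
have : tform k x v v = 0.
  rewrite tform_lin !(tformC k x _ v) !tform_lin (tformC k x y z) T !tform_sn//.
  by rewrite -/s -/t /m; field; rewrite gt_eqF.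
move=> /(tform_eq0 mx) vE.
have a0 : 0 <= cs k s - m * cs k t.
  have -> : cs k s - m * cs k t = sn k (t - s) / sn k t.
    by rewrite snB /m; field; rewrite gt_eqF.
  rewrite divr_ge0 ?(ltW snt)// sn_ge0//; first lra.
  by apply: sqrtM_le (ltW kt); lra.
exists (cs k s - m * cs k t), m; split => //.
  by rewrite divr_ge0 ?(ltW snt)// sn_model_dist_ge0.
have fv : model_form k v x = cs k s - m * cs k t.
  by rewrite model_form_lin !cs_model_dist// (model_formC k z) (model_formC k y); ring.
by apply: lin2_solve; rewrite -fv.
Qed.

Definition lin3 a A b B c C := lin2 1 (lin2 a A b B) c C.

(** The convex cone over a triangle, cut with the surface: a description of the
    triangle that is symmetric in the vertices and shows its convexity. *)
Definition cone k A B C P := model_space k P /\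
  exists a b c, [/\ 0 <= a, 0 <= b, 0 <= c & P = lin3 a A b B c C].

Lemma lin3E a A b B c C : lin3 a A b B c C =
  (a * A.1.1 + b * B.1.1 + c * C.1.1, a * A.1.2 + b * B.1.2 + c * C.1.2,
   a * A.2 + b * B.2 + c * C.2).
Proof. by rewrite /lin3 /lin2/=; congr (_, _, _); ring. Qed.

Lemma lin3_swap12 a A b B c C : lin3 a A b B c C = lin3 b B a A c C.
Proof. by rewrite !lin3E; congr (_, _, _); ring. Qed.

Lemma lin3_swap23 a A b B c C : lin3 a A b B c C = lin3 a A c C b B.
Proof. by rewrite !lin3E; congr (_, _, _); ring. Qed.

Lemma cone_swap12 k A B C P : cone k A B C P -> cone k B A C P.
Proof.
move=> [mP [a [b [c [a0 b0 c0 PE]]]]]; split=> //.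
by exists b, a, c; rewrite lin3_swap12.
Qed.

Lemma cone_swap23 k A B C P : cone k A B C P -> cone k A C B P.
Proof.
move=> [mP [a [b [c [a0 b0 c0 PE]]]]]; split=> //.
by exists a, c, b; rewrite lin3_swap23.
Qed.

Lemma model_triangleE k A B C P :
    model_space k A -> model_space k B -> model_space k C ->
    Num.sqrt k * (model_dist k B C + model_dist k A C + model_dist k A B) < 2 * pi ->
  model_triangle k A B C P <-> cone k A B C P.
Proof.
move=> mA mB mC per.
have kk := sqrtr_ge0 k; have pi0 := pi_gt0 R.
have kBC : Num.sqrt k * model_dist k B C < pi.
  have := model_dist_triangle mA mB mC; rewrite (model_distC k B A) => h.
  suff : Num.sqrt k * (2 * model_dist k B C) < 2 * pi by lra.
  by apply: le_lt_trans per; rewrite ler_wpM2l//; lra.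
split.
- move=> [D sD sP]; have [b [c [b0 c0 DE]]] := cone_of_segment mB mC kBC sD.
  have [mD eD] := sD.
  have kAD : Num.sqrt k * model_dist k A D < pi.
    have h1 := model_dist_triangle mB mA mD; have h2 := model_dist_triangle mC mA mD.
    rewrite (model_distC k C D) in h2.
    suff : Num.sqrt k * (2 * model_dist k A D) < 2 * pi by lra.
    by apply: le_lt_trans per; rewrite ler_wpM2l//; lra.
  have [a [d [a0 d0 PE]]] := cone_of_segment mA mD kAD sP.
  have [mP _] := sP; split=> //.
  exists a, (d * b), (d * c); split; rewrite ?mulr_ge0//.
  by rewrite PE DE lin3E /lin2/=; congr (_, _, _); ring.
- move=> [mP [a [b [c [a0 b0 c0 PE]]]]].
  pose n2 := b ^+ 2 + c ^+ 2 + 2 * b * c * cs k (model_dist k B C).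
  have csBC : -1 < cs k (model_dist k B C).
    have [k0|k0] := ltP 0 k; last first.
      rewrite cs_model_dist//; move: k0; rewrite le_eqVlt => /orP[/eqP k0|k0].
        by rewrite k0 in mB mC *; rewrite model_form0 !model0//; lra.
      by have := model_form_hyperbolic k0 mB mC; lra.
    rewrite /cs k0 -cospi ltr_cos// ?in_itv/= ?lexx ?pi_ge0//.
    by rewrite mulr_ge0 ?model_dist_ge0// ltW.
  have [bc0|bcn] := eqVneq (b + c) 0.
    have b0' : b = 0 by lra.
    have c0' : c = 0 by lra.
    exists B; first by apply: (@segment_of_cone k 1 0) => //; rewrite /lin2; 
      case: (B) => [[? ?] ?]/=; congr (_, _, _); ring.
    apply: (@segment_of_cone k a 0) => //.
    by rewrite PE b0' c0' lin3E /lin2/=; congr (_, _, _); ring.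
  have bc : 0 < b + c by rewrite lt_neqAle eq_sym bcn addr_ge0.
  have n20 : 0 < n2.
    have -> : n2 = (b - c) ^+ 2 + 2 * b * c * (1 + cs k (model_dist k B C)).
      by rewrite /n2; ring.
    have [bceq|bcneq] := eqVneq b c.
      rewrite bceq subrr expr0n add0r; have cpos : 0 < c by lra.
      by rewrite !mulr_gt0//; lra.
    apply: ltr_pwDl; first by rewrite lt_neqAle eq_sym sqrf_eq0 subr_eq0 bcneq sqr_ge0.
    by rewrite !mulr_ge0//; lra.
  pose n := Num.sqrt n2; have n0 : 0 < n by rewrite sqrtr_gt0.
  have nn : n ^+ 2 = n2 by rewrite sqr_sqrtr// ltW.
  pose D := lin2 (b / n) B (c / n) C.
  have mD : model_space k D.
    split.
      rewrite form_lin2_self//.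
      transitivity (n2 / n ^+ 2); last by rewrite -nn divff// expf_neq0// gt_eqF.
      by rewrite /n2; field; rewrite gt_eqF.
    move=> k0 /=.
    have B0 := (proj2 mB) k0; have C0 := (proj2 mC) k0.
    have -> : b / n * B.1.1 + c / n * C.1.1 = (b * B.1.1 + c * C.1.1) / n.
      by field; rewrite gt_eqF.
    rewrite divr_gt0//.
    have [bz|bn] := eqVneq b 0.
      rewrite bz mul0r add0r mulr_gt0//; lra.
    have b0' : 0 < b by rewrite lt_neqAle eq_sym bn.
    by apply: ltr_pwDl; rewrite ?mulr_gt0// mulr_ge0// ltW.
  exists D.
    by apply: (@segment_of_cone k (b / n) (c / n)); rewrite ?divr_ge0 ?(ltW n0).
  apply: (@segment_of_cone k a n); rewrite ?(ltW n0)//.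
  by rewrite PE lin3E /D /lin2/=; congr (_, _, _); field; rewrite gt_eqF.
Qed.

End Cone.

(** * Fermat points of model triangles *)

Section ModelFermat.
Set Implicit Arguments.
Unset Strict Implicit.
Context {R : realType}.
Implicit Types (k l p q r s t a b c e rho tau : R) (x y z u v w P A B C D Q : R * R * R).

(** If the angle A P C is less than 120 degrees, the sum of the two unit
    vectors at P that point to A and C has a length N > 1, and makes with each
    of them an angle of cosine N / 2 > 1/2.  A small move in its direction
    shortens the two legs by more than the length of the move. *)
Lemma bisector_move k P A C :
    model_space k P -> model_space k A -> model_space k C ->
    0 < model_dist k P A -> Num.sqrt k * model_dist k P A < pi ->
    0 < model_dist k P C -> Num.sqrt k * model_dist k P C < pi ->
    chord2 k (model_dist k A C) < hinge120 k (model_dist k P A) (model_dist k P C) ->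
  exists a b c, [/\ 0 <= a, 0 <= b, 0 <= c, model_space k (lin3 a P b A c C) &
    let Q := lin3 a P b A c C in
    model_dist k Q A + model_dist k Q C + model_dist k Q P
      < model_dist k P A + model_dist k P C].
Proof.
move=> mP mA mC; set p := model_dist k P A; set r := model_dist k P C.
move=> p0 kp r0 kr; rewrite (chord2_model_dist mP mA mC) -/p -/r /hinge => hT.
have sp := sn_gt0 p0 kp; have sr := sn_gt0 r0 kr.
have spr : 0 < sn k p * sn k r by rewrite mulr_gt0.
pose rho := tform k P A C / (sn k p * sn k r).
have Trho : tform k P A C = rho * sn k p * sn k r.
  by rewrite /rho; field; rewrite !gt_eqF.
have rho2 : - 2^-1 < rho by rewrite /rho ltr_pdivlMr//; lra.
pose N := Num.sqrt (2 + 2 * rho).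
have NN : N ^+ 2 = 2 + 2 * rho by rewrite sqr_sqrtr//; lra.
have N1 : 1 < N.
  by rewrite -(ltr_pXn2r (n := 2)) ?nnegrE ?ler01 ?sqrtr_ge0// expr1n NN; lra.
have N0 : 0 < N by lra.
(* tau is chosen between 1/2 and the cosine N / 2 *)
pose tau := (N + 1) / 4.
have tau1 : 1 / 2 < tau by rewrite /tau; lra.
have tauN : tau < N / 2 by rewrite /tau; lra.
(* the coefficient of P in cs s P + sn s V, where V is the unit vector of the
   move; it is positive for small s, so the move stays in the cone *)
pose co s := cs k s - sn k s * (cs k p / (N * sn k p) + cs k r / (N * sn k r)).
have cco : {for 0, continuous co}.
  by apply/differentiable_continuous/derivable1_diffP; exact: ex_derive.
have co0 : \forall s \near 0^'+, 0 < co s.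
  apply: cvg_within; apply: (cvgr_gt (co 0) cco); rewrite /co sn0 cs0.
  by lra.
have kk := sqrtr_ge0 k; have pi0 := pi_gt0 R.
pose m := Num.min (pi / (1 + Num.sqrt k)) (Num.min (p / tau) (r / tau)).
have m0 : 0 < m by rewrite !lt_min !divr_gt0//; lra.
have [s [cos0 s0 sm fp fr]] : exists s, [/\ 0 < co s, 0 < s, s < m,
    hinge k p s (N / 2) < chord2 k (p - tau * s) &
    hinge k r s (N / 2) < chord2 k (r - tau * s)].
  apply: (@filter_ex _ 0^'+); near=> s; split; near: s => //.
  - exact: nbhs_right_gt.
  - exact: nbhs_right_lt.
  - exact: first_variation.
  - exact: first_variation.
move: sm; rewrite /m !lt_min => /and3P[].
rewrite !ltr_pdivlMr ?(lt_trans _ tau1)//; try lra.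
rewrite !(mulrC s tau) => ks sp' sr'.
have {}ks : Num.sqrt k * s < pi by lra.
have sns : 0 < sn k s by apply: sn_gt0.
pose b := sn k s / (N * sn k p); pose c := sn k s / (N * sn k r).
have b0 : 0 < b by rewrite divr_gt0// mulr_gt0.
have c0 : 0 < c by rewrite divr_gt0// mulr_gt0.
exists (co s), b, c.
set Q := lin3 (co s) P b A c C.
have TQ x : tform k P Q x = b * tform k P A x + c * tform k P C x.
  by rewrite /Q /lin3 !tform_lin tform_self//; ring.
have QP : model_form k Q P = cs k s.
  rewrite /Q /lin3 !model_form_lin (proj1 mP) !(model_formC k _ P).
  rewrite -!cs_model_dist// -/p -/r /co /b /c; field.
  by rewrite !gt_eqF.
have TQA : tform k P Q A = sn k s * sn k p * (N / 2).
  rewrite TQ tform_sn// (tformC _ _ C) Trho -/p /b /c.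
  transitivity (sn k s * sn k p * (2 + 2 * rho) / (2 * N)).
    by field; rewrite !gt_eqF.
  by rewrite -NN; field; rewrite gt_eqF.
have TQC : tform k P Q C = sn k s * sn k r * (N / 2).
  rewrite TQ tform_sn// Trho -/r /b /c.
  transitivity (sn k s * sn k r * (2 + 2 * rho) / (2 * N)).
    by field; rewrite !gt_eqF.
  by rewrite -NN; field; rewrite gt_eqF.
have TQQ : tform k P Q Q = sn k s ^+ 2.
  rewrite TQ !(tformC _ _ _ Q) TQA TQC /b /c.
  by field; rewrite !gt_eqF.
have mQ : model_space k Q.
  split.
    have [k0|k0] := eqVneq k 0.
      have P1 : P.1.1 = 1 by apply: model0; rewrite -k0.
      by move: QP; rewrite k0 !model_form0 cs_flat P1 mulr1 => ->; rewrite mulr1.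
    move: TQQ; rewrite tformE// QP => h.
    have := csDksn k s; rewrite -h => <-; by field.
  move=> k0; have P0 := proj2 mP k0; have A0 := proj2 mA k0; have C0 := proj2 mC k0.
  by rewrite /Q lin3E /= !addr_gt0// mulr_gt0.
have dQP : model_dist k Q P = s.
  rewrite model_distC; apply: (@dist_of_chord2 _ k) => //; try exact: ltW.
  apply: sn_cs_chord2; last by rewrite cs_model_dist// model_formC.
  apply/eqP; rewrite -(@eqrXn2 _ 2) ?sn_model_dist_ge0 ?(ltW sns)//.
  by rewrite -tform_sn// TQQ.
have bound x d : model_space k x -> model_dist k P x = d -> tau * s <= d ->
    hinge k d s (N / 2) < chord2 k (d - tau * s) ->
    tform k P Q x = sn k s * sn k d * (N / 2) -> model_dist k Q x < d - tau * s.
  move=> mx dE td h T.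
  rewrite ltNge; apply/negP => le.
  have : chord2 k (d - tau * s) <= chord2 k (model_dist k Q x).
    by apply: chord2_leD => //; [lra|exact: model_dist_le].
  rewrite leNgt (chord2_model_dist mP mQ mx) dE (model_distC k P) dQP T => /negP; apply.
  by apply: le_lt_trans h; rewrite /hinge; lra.
have := bound A p mA erefl _ fp TQA; have := bound C r mC erefl _ fr TQC.
rewrite -/p -/r => h1 h2; split => //; try exact: ltW.
rewrite /= dQP; have {}h1 := h1 (ltW sr'); have {}h2 := h2 (ltW sp').
have : 1 / 2 * s < tau * s by rewrite ltr_pM2r.
move: h1 h2; clear; move: (model_dist k Q A) (model_dist k Q C) => *; lra.
Unshelve. all: by end_near. Qed.

Lemma cone_move k A B C P a b c : cone k A B C P -> 0 <= a -> 0 <= b -> 0 <= c ->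
  model_space k (lin3 a P b A c C) -> cone k A B C (lin3 a P b A c C).
Proof.
move=> [mP [x [y [z [x0 y0 z0 ->]]]]] a0 b0 c0 m; split=> //.
exists (a * x + b), (a * y), (a * z + c); split; rewrite ?addr_ge0 ?mulr_ge0//.
by rewrite !lin3E/=; congr (_, _, _); ring.
Qed.

Lemma cone_vertex3 k A B C : model_space k C -> cone k A B C C.
Proof.
move=> mC; split=> //; exists 0, 0, 1; split => //.
by rewrite lin3E; case: (C) => [[x y] z]/=; congr (_, _, _); ring.
Qed.

Lemma cone_vertex2 k A B C : model_space k B -> cone k A B C B.
Proof. by move=> mB; apply/cone_swap23/cone_vertex3. Qed.

Lemma cone_vertex1 k A B C : model_space k A -> cone k A B C A.
Proof. by move=> mA; apply/cone_swap12/cone_vertex2. Qed.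

Definition cone_min k A B C P := cone k A B C P /\
  forall Q, cone k A B C Q ->
    model_dist k P A + model_dist k P B + model_dist k P C <=
    model_dist k Q A + model_dist k Q B + model_dist k Q C.

Lemma cone_min_swap12 k A B C P : cone_min k A B C P -> cone_min k B A C P.
Proof.
move=> [cP h]; split; first exact: cone_swap12.
by move=> Q /cone_swap12/h; lra.
Qed.

Lemma cone_min_swap23 k A B C P : cone_min k A B C P -> cone_min k A C B P.
Proof.
move=> [cP h]; split; first exact: cone_swap23.
by move=> Q /cone_swap23/h; lra.
Qed.

Lemma cone_min_angle_ge k A B C P :
    model_space k A -> model_space k B -> model_space k C -> cone_min k A B C P ->
    0 < model_dist k P A -> Num.sqrt k * model_dist k P A < pi ->
    0 < model_dist k P C -> Num.sqrt k * model_dist k P C < pi ->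
  hinge120 k (model_dist k P A) (model_dist k P C) <= chord2 k (model_dist k A C).
Proof.
move=> mA mB mC [cP minP] p0 kp r0 kr; rewrite leNgt; apply/negP => h.
have mP := proj1 cP.
have [a [b [c [a0 b0 c0 mQ]]]] := bisector_move mP mA mC p0 kp r0 kr h.
have := minP _ (cone_move cP a0 b0 c0 mQ).
have := model_dist_triangle mP mQ mB.
by rewrite /=; lra.
Qed.

(** The sum of the three equations has nonpositive terms a (1 + u + v),
    b (1 + u + w), c (1 + v + w), of which the first two have negative factors. *)
Lemma nonneg_relation_eq0 a b c (u v w : R) : 0 <= a -> 0 <= b -> 0 <= c ->
    u < - 2^-1 -> v <= - 2^-1 -> w <= - 2^-1 ->
    a + b * u + c * v = 0 -> a * u + b + c * w = 0 -> a * v + b * w + c = 0 ->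
  [/\ a = 0, b = 0 & c = 0].
Proof.
move=> a0 b0 c0 hu hv hw eA eB eC.
have h1 : a * (1 + u + v) <= 0 by rewrite mulr_ge0_le0//; lra.
have h2 : b * (1 + u + w) <= 0 by rewrite mulr_ge0_le0//; lra.
have h3 : c * (1 + v + w) <= 0 by rewrite mulr_ge0_le0//; lra.
have /eqP : a * (1 + u + v) = 0 by lra.
rewrite mulf_eq0 (@lt_eqF _ _ (1 + u + v) 0) ?orbF; last lra.
move=> /eqP az; have /eqP : b * (1 + u + w) = 0 by lra.
rewrite mulf_eq0 (@lt_eqF _ _ (1 + u + w) 0) ?orbF; last lra.
by move=> /eqP bz; split => //; rewrite az bz in eC; lra.
Qed.

(** The minimizer is a combination of A, B, C with nonnegative coefficients, so
    the directions from P to the vertices satisfy a linear relation with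
    nonnegative coefficients.  The cosines v, w of two of the angles are at most
    -1/2 by cone_min_angle_ge; if the third one, u, were less than -1/2, the
    products of the relation with the unit directions would be as in
    nonneg_relation_eq0. *)
Lemma cone_min_angle_le k A B C P :
    model_space k A -> model_space k B -> model_space k C -> cone_min k A B C P ->
    0 < model_dist k P A -> Num.sqrt k * model_dist k P A < pi ->
    0 < model_dist k P B -> Num.sqrt k * model_dist k P B < pi ->
    0 < model_dist k P C -> Num.sqrt k * model_dist k P C < pi ->
  chord2 k (model_dist k A B) <= hinge120 k (model_dist k P A) (model_dist k P B).
Proof.
move=> mA mB mC mn p0 kp q0 kq r0 kr; rewrite leNgt; apply/negP.
have mP := proj1 (proj1 mn).
have hAC := cone_min_angle_ge mA mB mC mn p0 kp r0 kr.
have hBC := cone_min_angle_ge mB mA mC (cone_min_swap12 mn) q0 kq r0 kr.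
move: hAC hBC.
rewrite (chord2_model_dist mP mA mB) (chord2_model_dist mP mA mC).
rewrite (chord2_model_dist mP mB mC) /hinge.
have sp := sn_gt0 p0 kp; have sq := sn_gt0 q0 kq; have sr := sn_gt0 r0 kr.
have [_ [a [b [c [a0 b0 c0 PE]]]]] := proj1 mn.
have T0 x : a * tform k P A x + b * tform k P B x + c * tform k P C x = 0.
  have := tform_self x mP; rewrite {2}PE /lin3 !tform_lin; lra.
have := T0 A; have := T0 B; have := T0 C; rewrite !tform_sn//.
rewrite (tformC k P B A) (tformC k P C A) (tformC k P C B).
move: (sn k (model_dist k P A)) (sn k (model_dist k P B)) (sn k (model_dist k P C))
  sp sq sr => x y z sp sq sr.
pose u := tform k P A B / (x * y).
pose v := tform k P A C / (x * z).
pose w := tform k P B C / (y * z).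
have -> : tform k P A B = u * (x * y) by rewrite /u divfK// mulf_neq0// gt_eqF.
have -> : tform k P A C = v * (x * z) by rewrite /v divfK// mulf_neq0// gt_eqF.
have -> : tform k P B C = w * (y * z) by rewrite /w divfK// mulf_neq0// gt_eqF.
move: u v w => u v w eC eB eA hAC hBC hAB.
have xy : 0 < x * y by rewrite mulr_gt0.
have xz : 0 < x * z by rewrite mulr_gt0.
have yz : 0 < y * z by rewrite mulr_gt0.
have hv : v <= - 2^-1 by rewrite -(ler_pM2r xz); lra.
have hw : w <= - 2^-1 by rewrite -(ler_pM2r yz); lra.
have hu : u < - 2^-1 by rewrite -(ltr_pM2r xy); lra.
have ax : 0 <= a * x by rewrite mulr_ge0// ltW.
have By : 0 <= b * y by rewrite mulr_ge0// ltW.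
have cz : 0 <= c * z by rewrite mulr_ge0// ltW.
have {}eA : a * x + b * y * u + c * z * v = 0.
  by apply: (mulIf (lt0r_neq0 sp)); rewrite mul0r -eA; ring.
have {}eB : a * x * u + b * y + c * z * w = 0.
  by apply: (mulIf (lt0r_neq0 sq)); rewrite mul0r -eB; ring.
have {}eC : a * x * v + b * y * w + c * z = 0.
  by apply: (mulIf (lt0r_neq0 sr)); rewrite mul0r -eC; ring.
have [ax0 by0 cz0] := nonneg_relation_eq0 ax By cz hu hv hw eA eB eC.
move: (proj1 mP); rewrite {1}PE /lin3 !model_form_lin.
have -> : a = 0 by apply: (mulIf (lt0r_neq0 sp)); rewrite mul0r.
have -> : b = 0 by apply: (mulIf (lt0r_neq0 sq)); rewrite mul0r.
have -> : c = 0 by apply: (mulIf (lt0r_neq0 sr)); rewrite mul0r.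
by rewrite !mul0r !addr0 mulr0 => /eqP; rewrite eq_sym oner_eq0.
Qed.

(** At an interior minimizer, cone_min_angle_le applies to the three angles.  At
    the vertex C the claim is the hypothesis on the angle there; a minimizer at
    A or B forces equalities between sides which reduce it to the same
    hypothesis. *)
Lemma model_fermat k A B C P a b c :
    model_space k A -> model_space k B -> model_space k C -> cone_min k A B C P ->
    model_dist k B C = a -> model_dist k A C = b -> model_dist k A B = c ->
    0 < a -> a <= b -> b <= c -> Num.sqrt k * c < pi ->
    chord2 k c <= hinge120 k a b ->
  let p := model_dist k P A in let q := model_dist k P B in
  let r := model_dist k P C in
  [/\ [/\ p <= b, p <= c, q <= a & q <= c], r <= a /\ r <= b,
      [/\ 0 <= p, 0 <= q & 0 <= r],
      [/\ `|p - q| <= c <= p + q, `|p - r| <= b <= p + r & `|q - r| <= a <= q + r] &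
      [/\ chord2 k c <= hinge120 k p q, chord2 k b <= hinge120 k p r &
          chord2 k a <= hinge120 k q r]].
Proof.
move=> mA mB mC mn eBC eAC eAB a0 ab bc kc vert p q r.
have mP := proj1 (proj1 mn).
have fA := (proj2 mn) A (cone_vertex1 B C mA).
have fB := (proj2 mn) B (cone_vertex2 A C mB).
have fC := (proj2 mn) C (cone_vertex3 A B mC).
rewrite -/p -/q -/r model_distxx// eAB eAC in fA.
rewrite -/p -/q -/r model_distxx// (model_distC k B A) eAB eBC in fB.
rewrite -/p -/q -/r model_distxx// (model_distC k C A) (model_distC k C B) eAC eBC in fC.
have p0 : 0 <= p by apply: model_dist_ge0.
have q0 : 0 <= q by apply: model_dist_ge0.
have r0 : 0 <= r by apply: model_dist_ge0.
have tri x y : model_space k x -> model_space k y ->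
    `|model_dist k P x - model_dist k P y| <= model_dist k x y
    <= model_dist k P x + model_dist k P y.
  move=> mx my; have h1 := model_dist_triangle mP mx my.
  have h2 := model_dist_triangle mx mP my; have h3 := model_dist_triangle my mP mx.
  rewrite (model_distC k x P) in h1; rewrite (model_distC k y x) in h3.
  by rewrite ler_norml; apply/andP; split; [apply/andP; split|]; lra.
have tAB := tri _ _ mA mB; have tAC := tri _ _ mA mC; have tBC := tri _ _ mB mC.
rewrite -/p -/q -/r eAB eAC eBC in tAB tAC tBC.
have [/andP[_ tAB2] /andP[_ tAC2] /andP[_ tBC2]] := And3 tAB tAC tBC.
have pb : p <= b by lra.
have pc : p <= c by lra.
have qa : q <= a by lra.
have qc : q <= c by lra.
have ra : r <= a by lra.
have rb : r <= b by lra.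
split => //.
have lt (d : R) : d <= c -> Num.sqrt k * d < pi.
  by move=> xc; apply: le_lt_trans kc; rewrite ler_wpM2l// sqrtr_ge0.
have [p00|pn] := eqVneq p 0.
  have Ceq : c = a by lra.
  have -> : q = c by rewrite p00 sub0r ler_norml in tAB; lra.
  have -> : r = b by rewrite p00 sub0r ler_norml in tAC; lra.
  rewrite p00 !hinge_0l; split => //.
  have -> : b = a by lra.
  by move: vert; rewrite Ceq (_ : b = a)//; lra.
have [q00|qn] := eqVneq q 0.
  have Ceq : c = b by lra.
  have -> : p = c by rewrite q00 subr0 ler_norml in tAB; lra.
  have -> : r = a by rewrite q00 sub0r ler_norml in tBC; lra.
  rewrite q00 !(hingeC _ _ 0) !hinge_0l; split => //.
  by rewrite hingeC -Ceq in vert *.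
have [r00|rn] := eqVneq r 0.
  have -> : p = b by rewrite r00 subr0 ler_norml in tAC; lra.
  have -> : q = a by rewrite r00 subr0 ler_norml in tBC; lra.
  by rewrite r00 !(hingeC _ _ 0) !hinge_0l; split => //; rewrite hingeC.
have p0' : 0 < p by rewrite lt_neqAle eq_sym pn.
have q0' : 0 < q by rewrite lt_neqAle eq_sym qn.
have r0' : 0 < r by rewrite lt_neqAle eq_sym rn.
have kp := lt p pc; have kq := lt q qc; have kr := lt r (le_trans rb bc).
split.
- by rewrite -eAB; apply: (cone_min_angle_le mA mB mC mn).
- by rewrite -eAC; apply: (cone_min_angle_le mA mC mB (cone_min_swap23 mn)).
- rewrite -eBC; apply: (cone_min_angle_le mB mC mA _) => //.
  exact/cone_min_swap23/cone_min_swap12.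
Qed.

End ModelFermat.

(** * Hinges in CAT(k) spaces *)

Section Hinges.
Set Implicit Arguments.
Unset Strict Implicit.
Context {R : realType}.
Implicit Types (k l p q r s t a b c e h rho tau : R).

Lemma hinge_exists k p h t : 0 < p -> 0 < h -> `|p - h| <= t <= p + h ->
    Num.sqrt k * (p + h + t) < 2 * pi ->
  exists rho, -1 <= rho <= 1 /\ chord2 k t = hinge k p h rho.
Proof.
move=> p0 h0 /andP[+ tph] per; rewrite ler_norml => pht.
have kk := sqrtr_ge0 k; have pi0 := pi_gt0 R.
have half x : 0 <= x -> x <= (p + h + t) / 2 -> 0 <= sn k x.
  move=> x0 xle; apply: sn_ge0 => //.
  by apply: (sqrtM_le xle); lra.
have lt_pi x : x <= (p + h + t) / 2 -> Num.sqrt k * x < pi.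
  move=> xle; apply: (@le_lt_trans _ _ (Num.sqrt k * ((p + h + t) / 2))).
    by rewrite ler_wpM2l.
  by lra.
have sp : 0 < sn k p by apply: sn_gt0 => //; apply: lt_pi; lra.
have sh : 0 < sn k h by apply: sn_gt0 => //; apply: lt_pi; lra.
have phs : 0 < sn k p * sn k h by rewrite mulr_gt0.
exists ((chord2 k p + chord2 k h - k / 2 * chord2 k p * chord2 k h - chord2 k t)
  / (2 * (sn k p * sn k h))); split; last first.
  by rewrite /hinge; field; rewrite !gt_eqF.
rewrite ler_pdivlMr ?ler_pdivrMr ?mulr_gt0//.
have lo : chord2 k (p - h) <= chord2 k t.
  rewrite -subr_ge0 chord2B mulr_ge0// ?mulr_ge0//; apply: half; lra.
have up : chord2 k t <= chord2 k (p + h).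
  rewrite -subr_ge0 chord2B mulr_ge0// ?mulr_ge0//; apply: half; lra.
rewrite chord2_sub in lo; rewrite chord2D in up.
by apply/andP; split; lra.
Qed.

Lemma sqr_cosin rho : -1 <= rho <= 1 -> rho ^+ 2 + Num.sqrt (1 - rho ^+ 2) ^+ 2 = 1.
Proof.
move=> /andP[h1 h2]; rewrite sqr_sqrtr; first by ring.
have : 0 <= (1 - rho) * (1 + rho) by rewrite mulr_ge0//; lra.
lra.
Qed.

(** The triangle inequality in the model surface, for the two hinges glued along
    their common leg h. *)
Lemma hinge_bisector k p q h rho t1 t2 : -1 <= rho <= 1 ->
    0 <= t1 -> 0 <= t2 -> Num.sqrt k * (t1 + t2) <= pi ->
    hinge k p h rho <= chord2 k t1 -> hinge k q h rho <= chord2 k t2 ->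
  hinge k p q (2 * rho ^+ 2 - 1) <= chord2 k (t1 + t2).
Proof.
move=> rho1 t10 t20 kt H1 H2; have e2 := sqr_cosin rho1.
set e := Num.sqrt _ in e2.
have e2' : rho ^+ 2 + (- e) ^+ 2 = 1 by rewrite sqrrN.
have u2 : 1 ^+ 2 + 0 ^+ 2 = 1 :> R by rewrite expr1n expr0n addr0.
have mA := polar_model k p e2; have mB := polar_model k q e2'.
have mD := polar_model k h u2.
have tri := model_dist_triangle mD mA mB.
have dA : model_dist k (polar k p rho e) (polar k h 1 0) <= t1.
  apply: (@le_of_chord2 _ k) => //; first exact: model_dist_le.
  by rewrite chord2_polar//; apply: le_trans H1; rewrite mulr1 mulr0 addr0.
have dB : model_dist k (polar k h 1 0) (polar k q rho (- e)) <= t2.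
  apply: (@le_of_chord2 _ k) => //; first exact: model_dist_le.
  rewrite chord2_polar// hingeC; apply: le_trans H2.
  by rewrite mul1r mul0r addr0.
have -> : 2 * rho ^+ 2 - 1 = rho * rho + e * - e by lra.
rewrite -(chord2_polar _ _ _ e2 e2').
apply: chord2_leD => //; [exact: model_dist_ge0|lra].
Qed.

End Hinges.

Section CATHinge.
Set Implicit Arguments.
Unset Strict Implicit.
Context {R : realType} {X : metricType R}.
Implicit Types (k p q r s t a b c e h rho tau : R) (A B C D O P Q : X).

Lemma geodesic_dist A B (g : R -> X) s : geodesic A B g ->
  s \in `[0, mdist A B] ->
  mdist A (g s) = s /\ mdist B (g s) = mdist A B - s.
Proof.
move=> [g0 g1 gi] si; have := si; rewrite in_itv/= => /andP[s0 s1].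
have i0 : 0 \in `[0, mdist A B] by rewrite in_itv/= lexx mdist_ge0.
have i1 : mdist A B \in `[0, mdist A B] by rewrite in_itv/= lexx mdist_ge0.
rewrite -{1}g0 -{1}g1 !gi// sub0r normrN ger0_norm// ger0_norm//.
by rewrite subr_ge0.
Qed.

(** Comparison angles at O decrease when the end of a leg moves towards O. *)
Lemma CAT_hinge k O A D (g : R -> X) s rho : CAT X k -> geodesic O D g ->
    Num.sqrt k * (mdist O A + mdist O D + mdist A D) < 2 * pi ->
    0 < mdist O A -> 0 < mdist O D -> s \in `[0, mdist O D] ->
    chord2 k (mdist A D) <= hinge k (mdist O A) (mdist O D) rho ->
  chord2 k (mdist A (g s)) <= hinge k (mdist O A) s rho.
Proof.
move=> [geo cat] gOD; set p := mdist O A; set h := mdist O D; set t := mdist A D.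
move=> per p0 h0 si.
have t1 : t <= p + h by rewrite /t /p (metric_sym O A) metric_triangle.
have t2 : p <= h + t by rewrite /p /h /t (metric_sym A D) metric_triangle.
have t3 : h <= p + t by rewrite metric_triangle.
have t0 : 0 <= t by apply: mdist_ge0.
have kk := sqrtr_ge0 k.
have [|rho0 [rho01 tE]] := hinge_exists p0 h0 _ per.
  by rewrite t1 andbT ler_norml; apply/andP; split; lra.
have lt_pi x : x <= (p + h + t) / 2 -> Num.sqrt k * x < pi.
  move=> xle; apply: (@le_lt_trans _ _ (Num.sqrt k * ((p + h + t) / 2))).
    by rewrite ler_wpM2l.
  by lra.
have := si; rewrite in_itv/= => /andP[s0 sh].
have sp : 0 < sn k p by apply: sn_gt0 => //; apply: lt_pi; lra.
have snh : 0 < sn k h by apply: sn_gt0 => //; apply: lt_pi; lra.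
have sns : 0 <= sn k s by apply: sn_ge0 => //; apply/ltW/lt_pi; lra.
rewrite tE => hrho.
have rho0rho : rho <= rho0.
  have phs : 0 < sn k p * sn k h by rewrite mulr_gt0.
  by rewrite -(ler_pM2l phs); rewrite /hinge in hrho; lra.
have e2 := sqr_cosin rho01; set e := Num.sqrt _ in e2.
have u2 : 1 ^+ 2 + 0 ^+ 2 = 1 :> R by rewrite expr1n expr0n addr0.
have [gs1 gs2] := geodesic_dist gOD si.
have [gA gAE] := geo A O; have [gD gDE] := geo A D.
have per' : ((mdist A O + mdist O D + mdist A D)%:E < 2%:E * model_diam k)%E.
  rewrite (metric_sym A O) -/p -/h -/t /model_diam; case: ifP => k0.
    rewrite -EFinM lte_fin mulrA ltr_pdivlMr ?sqrtr_gt0//; lra.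
  by rewrite gt0_muley ?lte_fin// ltry.
have := cat A O D gA g gD gAE gOD gDE per'
  (polar k p rho0 e) (polar k 0 1 0) (polar k h 1 0)
  (polar_model k p e2) (polar_model k 0 u2) (polar_model k h u2).
rewrite (metric_sym A O) -/p -/h -/t => {}cat.
have {}cat := cat _ _ _ s (polar k s 1 0) si (polar_model k s u2).
rewrite gs1 gs2 -/h in cat.
have le : mdist A (g s) <= model_dist k (polar k p rho0 e) (polar k s 1 0).
  apply: cat.
  - apply: model_dist_polar => //; [exact: ltW|by apply/ltW/lt_pi; lra|].
    by rewrite hingeC hinge_0l.
  - apply: model_dist_polar => //; [exact: ltW|by apply/ltW/lt_pi; lra|].
    by rewrite hinge_0l.
  - apply: model_dist_polar => //; [by apply/ltW/lt_pi; lra|].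
    by rewrite tE mulr1 mulr0 addr0.
  - apply: model_dist_polar => //; [by apply/ltW/lt_pi; lra|].
    by rewrite hinge_0l.
  - apply: model_dist_polar => //; [lra|by apply/ltW/lt_pi; lra|].
    by rewrite hingeE mulr1 mulr0 addr0; ring.
have /(@chord2_leD _ k) := le => /(_ (mdist_ge0 _ _)) {}le.
apply: le_trans (le _) _; first exact: model_dist_le (polar_model _ _ _) (polar_model _ _ _).
rewrite chord2_polar// mulr1 mulr0 addr0 /hinge lerD2l lerN2.
by rewrite ler_wpM2l// mulr_ge0 ?mulr_ge0// ltW.
Qed.

Lemma clamp_lip c x y :
  `|Num.max 0 (Num.min x c) - Num.max 0 (Num.min y c)| <= `|x - y|.
Proof.
wlog xy : x y / x <= y.
  move=> W; have [/W//|/ltW/W] := leP x y.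
  by rewrite (distrC (Num.max _ _)) (distrC y).
rewrite (distrC (Num.max _ _)) (distrC x) !ger0_norm ?subr_ge0//; last first.
  by rewrite le_max2// le_min2.
case: (leP x c) => xc; case: (leP y c) => yc.
- by case: (leP 0 x) => *; case: (leP 0 y) => *; lra.
- by case: (leP 0 x) => *; case: (leP 0 c) => *; lra.
- lra.
- by rewrite subrr subr_ge0.
Qed.

(** By hinge_bisector, the hinges of angle arccos rho facing [0, t] and [t, c]
    cannot both be shorter than these two parts of AB.  By continuity there is
    an end point where no hinge is too short, or a t where both fall short by
    the same amount, hence not at all. *)
Lemma CAT_bisector k P A B (g : R -> X) rho : geodesic A B g ->
    0 <= rho <= 1 -> Num.sqrt k * mdist A B <= pi ->
    chord2 k (mdist A B) < hinge k (mdist P A) (mdist P B) (2 * rho ^+ 2 - 1) ->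
  exists2 t, t \in `[0, mdist A B] &
    chord2 k t <= hinge k (mdist P A) (mdist P (g t)) rho /\
    chord2 k (mdist A B - t) <= hinge k (mdist P B) (mdist P (g t)) rho.
Proof.
move=> gAB /andP[rho0 rho1]; have := gAB => -[g0 g1 gi].
set c := mdist A B; set p := mdist P A; set q := mdist P B => kc H.
have c0 : 0 <= c by apply: mdist_ge0.
(* freeze the parameter outside of [0, c] *)
pose cl t := Num.max 0 (Num.min t c).
have cli t : cl t \in `[0, c].
  by rewrite in_itv/= /cl le_max lexx/= ge_max c0 ge_min lexx orbT.
have clK t : t \in `[0, c] -> cl t = t.
  rewrite in_itv/= => /andP[t0 tc].
  by rewrite /cl min_l// max_r.
pose h t := mdist P (g (cl t)).
have ch : continuous h.
  move=> x; apply/cvgrPdist_lt => e e0; near=> y.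
  have lip : `|h x - h y| <= `|x - y|.
    have : `|h x - h y| <= mdist (g (cl x)) (g (cl y)).
      have h1 := metric_triangle P (g (cl x)) (g (cl y)).
      have h2 := metric_triangle P (g (cl y)) (g (cl x)).
      rewrite (metric_sym (g (cl y))) in h2.
      by rewrite ler_norml /h; apply/andP; split; lra.
    move=> /le_trans; apply; rewrite gi//; exact: clamp_lip.
  apply: le_lt_trans lip _; near: y.
  exact: cvgr_dist_lt.
pose EA t := chord2 k t - hinge k p (h t) rho.
pose EB t := chord2 k (c - t) - hinge k q (h t) rho.
have cF : continuous (fun t => EA t - EB t).
  move=> x; have c1 := @continuous_chord2 R k.
  have chx : {for x, continuous (fun t => chord2 k (h t))}.
    exact: (@continuous_comp _ _ _ h (chord2 k) x (ch x) (c1 _)).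
  have snx : {for x, continuous (fun t => sn k (h t))}.
    exact: (@continuous_comp _ _ _ h (sn k) x (ch x) (@continuous_sn R k _)).
  have cc : {for x, continuous (fun t => chord2 k (c - t))}.
    by apply/differentiable_continuous/derivable1_diffP; exact: ex_derive.
  have hh p' : {for x, continuous (fun t => hinge k p' (h t) rho)}.
    rewrite /hinge; apply: cvgB; first apply: cvgB; first apply: cvgD.
    - exact: cvg_cst.
    - exact: chx.
    - by apply: cvgM; [exact: cvg_cst|exact: chx].
    - by apply: cvgM; [apply: cvgM; [exact: cvg_cst|exact: snx]|exact: cvg_cst].
  apply: cvgB; apply: cvgB; [exact: c1|exact: hh|exact: cc|exact: hh].
have h0 : h 0 = p by rewrite /h clK ?g0// in_itv/= lexx.
have hc : h c = q by rewrite /h clK ?g1// in_itv/= lexx andbT.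
have EA0 : EA 0 <= 0.
  rewrite /EA h0 chord20 hingeE subrr chord20 !add0r oppr_le0.
  by rewrite mulr_ge0 ?subr_ge0// -mulrA mulr_ge0// -expr2 sqr_ge0.
have EBc : EB c <= 0.
  rewrite /EB hc subrr chord20 hingeE subrr chord20 !add0r oppr_le0.
  by rewrite mulr_ge0 ?subr_ge0// -mulrA mulr_ge0// -expr2 sqr_ge0.
suff [t ti [hA hB]] : exists2 t, t \in `[0, c] & EA t <= 0 /\ EB t <= 0.
  exists t => //; move: hA hB; rewrite /EA /EB /h clK// => hA hB.
  by split; lra.
(* EA 0 and EB c are nonpositive; unless an end point works, EA and EB have
   equal values somewhere in between *)
have [hB0|hB0] := leP (EB 0) 0; first by exists 0; rewrite ?in_itv/= ?lexx.
have [hAc|hAc] := leP (EA c) 0; first by exists c; rewrite ?in_itv/= ?lexx ?c0.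
have [||t ti E] := @IVT R (fun t => EA t - EB t) 0 c 0 c0.
- exact: continuous_subspaceT.
- by rewrite ge_min le_max; apply/andP; split; apply/orP; [left|right]; lra.
exists t => //; have [t0 tc] : 0 <= t /\ t <= c by move: ti; rewrite in_itv/= => /andP.
suff : ~ (0 < EA t) by move=> /negP; rewrite -leNgt; lra.
move=> EAt.
have kct : Num.sqrt k * (t + (c - t)) <= pi by rewrite subrKC.
have rho1' : -1 <= rho <= 1 by apply/andP; split; lra.
have ct0 : 0 <= c - t by lra.
have := @hinge_bisector _ k p q (h t) rho t (c - t) rho1' t0 ct0 kct.
rewrite subrKC => X0; move: H; rewrite ltNge => /negP; apply; apply: X0.
  by rewrite /EA in EAt; lra.
by rewrite /EA /EB in EAt E; lra.
Unshelve. all: by end_near. Qed.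

(** A move of length s from P towards the point found in CAT_bisector. *)
Lemma CAT_decrease k P A B rho tau s : CAT X k -> 0 <= rho <= 1 ->
    Num.sqrt k * (mdist P A + mdist P B + mdist A B) < 2 * pi ->
    0 < mdist P A -> 0 < mdist P B ->
    chord2 k (mdist A B) < hinge k (mdist P A) (mdist P B) (2 * rho ^+ 2 - 1) ->
    0 <= s -> mdist A B + 2 * s <= mdist P A + mdist P B ->
    mdist A B < mdist P A + mdist P B ->
    tau * s <= mdist P A -> tau * s <= mdist P B ->
    hinge k (mdist P A) s rho < chord2 k (mdist P A - tau * s) ->
    hinge k (mdist P B) s rho < chord2 k (mdist P B - tau * s) ->
  exists Q, [/\ mdist A Q <= mdist P A - tau * s, mdist B Q <= mdist P B - tau * s &
    mdist P Q = s].
Proof.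
move=> catX rho01; have [g gAB] := (proj1 catX) A B.
set c := mdist A B; set p := mdist P A; set q := mdist P B.
move=> per p0 q0 H s0 hs cpq tp tq Fp Fq.
have kk := sqrtr_ge0 k; have pi0 := pi_gt0 R.
have c0 : 0 <= c by apply: mdist_ge0.
have tri1 : p <= c + q by rewrite /p (metric_sym P A) /q (metric_sym P B) metric_triangle.
have tri2 : q <= p + c by rewrite metric_triangle.
have lt_pi x : x <= (p + q + c) / 2 -> Num.sqrt k * x < pi.
  move=> xle; apply: (@le_lt_trans _ _ (Num.sqrt k * ((p + q + c) / 2))).
    by rewrite ler_wpM2l.
  by lra.
have kc : Num.sqrt k * c <= pi by apply/ltW/lt_pi; lra.
have [t ti [hA hB]] := CAT_bisector gAB rho01 kc H.
have [dA dB] := geodesic_dist gAB ti; rewrite -/c in dB.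
have := ti; rewrite in_itv/= => /andP[t0 tc]; rewrite -/c in tc.
have [l gl] := (proj1 catX) P (g t).
set h := mdist P (g t) in hA hB.
have hp : h <= p + t by rewrite /h -{2}dA metric_triangle.
have hq : h <= q + (c - t) by rewrite /h -dB metric_triangle.
have ph : p <= h + t by rewrite /p /h -{2}dA (metric_sym A) metric_triangle.
have qh : q <= h + (c - t) by rewrite /q /h -dB (metric_sym B) metric_triangle.
have h0 : 0 < h by lra.
have si : s \in `[0, h] by rewrite in_itv/= s0; lra.
exists (l s).
have [dPQ _] := geodesic_dist gl si.
have lt_per x : x <= p + q + c -> Num.sqrt k * x < 2 * pi.
  by move=> xle; apply: le_lt_trans per; rewrite ler_wpM2l.
have bound C (d u : R) : mdist P C = d -> mdist C (g t) = u -> 0 < d ->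
    Num.sqrt k * (d + h + u) < 2 * pi -> chord2 k u <= hinge k d h rho ->
    tau * s <= d -> hinge k d s rho < chord2 k (d - tau * s) ->
    mdist C (l s) <= d - tau * s.
  move=> dE uE d0 pe hu td F; rewrite leNgt; apply/negP => lt.
  have := CAT_hinge (A := C) (rho := rho) catX gl _ _ h0 si.
  rewrite dE uE -/h => /(_ pe d0 hu).
  apply/negP; rewrite -ltNge; apply: (lt_le_trans F).
  apply: chord2_leD; rewrite ?subr_ge0 ?(ltW lt)//.
  apply/ltW/(@le_lt_trans _ _ (Num.sqrt k * ((d + h + u) / 2))); last lra.
  rewrite ler_wpM2l//.
  have := metric_triangle C P (l s); have := metric_triangle C (g t) (l s).
  have := (proj2 (geodesic_dist gl si)).
  by rewrite (metric_sym C P) dE uE dPQ -/h => ->; lra.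
split => //.
- by apply: (bound A p t) => //; apply: lt_per; lra.
- by apply: (bound B q (c - t)) => //; apply: lt_per; lra.
Qed.

End CATHinge.

(** * Limits of minimizing sequences *)

Section InfLimit.
Set Implicit Arguments.
Unset Strict Implicit.
Context {R : realType} {X : metricType R}.
Implicit Types (k p q r s t a b c e h rho tau : R) (A B C D O P Q : X).
Implicit Types (z w : R * R * R).

Definition sum_dist A B C Q := mdist A Q + mdist B Q + mdist C Q.

(** The infimum g of the sum of the distances need not be attained, as X need
    not be complete: a limit z of the distances to A, B, C along a minimizing
    sequence stands for the legs at a minimizer. *)
Definition inf_limit A B C g (z : R * R * R) :=
  (forall Q, g <= sum_dist A B C Q) /\
  (forall N e, nbhs z N -> 0 < e ->
     exists2 P, N (mdist A P, mdist B P, mdist C P) & sum_dist A B C P < g + e).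

(** The distances of near minimizers to A, B, C stay in a compact cube. *)
Lemma inf_limit_exists A B C :
  exists z, inf_limit A B C (min_sum_dist A B C) z.
Proof.
pose f x := sum_dist A B C x.
have hinf : has_inf (range f).
  split; first by exists (f A), A.
  by exists 0 => _ [x _ <-]; rewrite /f /sum_dist !addr_ge0 ?mdist_ge0.
set g := min_sum_dist A B C.
have lb Q : g <= f Q by apply: ge_inf; [exact: (proj2 hinf)|exists Q].
have ub e : 0 < e -> exists P, f P < g + e.
  by move=> e0; have [_ [P _ <-] h] := inf_adherent e0 hinf; exists P.
pose Phi P := (mdist A P, mdist B P, mdist C P).
(* the images of the sets of near minimizers generate a filter *)
pose F : set_system (R * R * R) :=
  fun N => exists2 e, 0 < e & forall P, f P < g + e -> N (Phi P).
have FF : ProperFilter F.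
  split.
    by move=> [e e0 h]; have [P /h] := ub e e0.
  split.
  - by exists 1.
  - move=> S T [e e0 hS] [d d0 hT]; exists (Num.min e d); first by rewrite lt_min e0.
    move=> P hP; split; [apply: hS|apply: hT]; apply: (lt_le_trans hP);
      by rewrite lerD2l ge_min lexx ?orbT.
  - by move=> S T ST [e e0 hS]; exists e => // P /hS/ST.
pose M := g + 1.
have cpt := compact_setX (compact_setX (@segment_compact R 0 M)
  (@segment_compact R 0 M)) (@segment_compact R 0 M).
have FM : F (`[0, M]%classic `*` `[0, M]%classic `*` `[0, M]%classic).
  exists 1 => // P; rewrite /f /sum_dist => h.
  have := mdist_ge0 A P; have := mdist_ge0 B P; have := mdist_ge0 C P.
  by move=> *; split; first split; rewrite /= in_itv/=; apply/andP; split => //;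
    rewrite /M; lra.
have [z [_ cz]] := cpt F FF FM.
exists z; split=> // N e nN e0.
have [w [[P hP <-] Nw]] : (Phi @` [set P | f P < g + e]) `&` N !=set0.
  by apply: cz => //; exists e => // P hP; exists P.
by exists P.
Qed.

Lemma near_lt_continuous (T : topologicalType) (u v : T -> R) (y : T) :
  {for y, continuous u} -> {for y, continuous v} -> u y < v y ->
  \forall x \near y, u x < v x.
Proof.
move=> cu cv uv.
have cvu : {for y, continuous (fun x => v x - u x)} by apply: cvgB.
have : \forall x \near y, 0 < v x - u x.
  by apply: (cvgr_gt _ cvu); rewrite subr_gt0.
by apply: filterS => x; rewrite subr_gt0.
Qed.

Lemma continuous_c1 z : {for z, continuous (fun w => w.1.1)}.
Proof. by apply: (cvg_comp fst fst); apply: cvg_fst. Qed.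

Lemma continuous_c2 z : {for z, continuous (fun w => w.1.2)}.
Proof. by apply: (cvg_comp fst snd); [exact: cvg_fst|exact: cvg_snd]. Qed.

Lemma continuous_c3 z : {for z, continuous (fun w => w.2)}.
Proof. exact: cvg_snd. Qed.

Lemma inf_limit_swap12 A B C g p q r :
  inf_limit A B C g (p, q, r) -> inf_limit B A C g (q, p, r).
Proof.
move=> [lb h]; split=> [Q|N e nN e0].
  by have := lb Q; rewrite /sum_dist; lra.
have cs : {for (p, q, r), continuous (fun w => (w.1.2, w.1.1, w.2))}.
  have c1 := @continuous_c1 (p, q, r); have c2 := @continuous_c2 (p, q, r).
  have c3 := @continuous_c3 (p, q, r).
  exact: (cvg_pair (cvg_pair c2 c1) c3).
have [P NP hP] := h _ e (cs N nN) e0.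
by exists P => //; move: hP; rewrite /sum_dist; lra.
Qed.

Lemma inf_limit_swap23 A B C g p q r :
  inf_limit A B C g (p, q, r) -> inf_limit A C B g (p, r, q).
Proof.
move=> [lb h]; split=> [Q|N e nN e0].
  by have := lb Q; rewrite /sum_dist; lra.
have cs : {for (p, q, r), continuous (fun w => (w.1.1, w.2, w.1.2))}.
  have c1 := @continuous_c1 (p, q, r); have c2 := @continuous_c2 (p, q, r).
  have c3 := @continuous_c3 (p, q, r).
  exact: (cvg_pair (cvg_pair c1 c3) c2).
have [P NP hP] := h _ e (cs N nN) e0.
by exists P => //; move: hP; rewrite /sum_dist; lra.
Qed.

Lemma inf_limit_le A B C g z (u v : R * R * R -> R) : inf_limit A B C g z ->
  {for z, continuous u} -> {for z, continuous v} ->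
  (forall P, u (mdist A P, mdist B P, mdist C P) <=
             v (mdist A P, mdist B P, mdist C P)) ->
  u z <= v z.
Proof.
move=> [_ h] cu cv uv; rewrite leNgt; apply/negP => lt.
have [P + _] := h _ 1 (near_lt_continuous cv cu lt) ltr01.
by apply/negP; rewrite -leNgt.
Qed.

Lemma inf_limit_sum A B C g p q r : inf_limit A B C g (p, q, r) -> p + q + r = g.
Proof.
move=> L; have [lb h] := L.
have cS : {for (p, q, r), continuous (fun w => w.1.1 + w.1.2 + w.2)}.
  apply: cvgD; last exact: continuous_c3.
  by apply: cvgD; [exact: continuous_c1|exact: continuous_c2].
apply/eqP; rewrite eq_le; apply/andP; split; last first.
  exact: (inf_limit_le (u := fun=> g) L (@cvg_cst _ _ _ _ _) cS).
rewrite leNgt; apply/negP => lt.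
have N : \forall w \near (p, q, r), (p + q + r + g) / 2 < w.1.1 + w.1.2 + w.2.
  by apply: near_lt_continuous cS _; [exact: cvg_cst|rewrite /=; lra].
have e0 : 0 < (p + q + r - g) / 2 by lra.
have [P /= h1 h2] := h _ _ N e0.
by move: h2; rewrite /sum_dist; lra.
Qed.

Lemma inf_limit_tri A B C g p q r : inf_limit A B C g (p, q, r) ->
  [/\ mdist A B <= p + q, p <= mdist A B + q, q <= mdist A B + p & 0 <= p].
Proof.
move=> L.
have c1 := @continuous_c1 (p, q, r); have c2 := @continuous_c2 (p, q, r).
split.
- apply: (inf_limit_le (u := fun=> mdist A B) (v := fun w => w.1.1 + w.1.2) L).
  + exact: cvg_cst.
  + exact: cvgD.
  + by move=> P /=; rewrite (metric_sym B P) metric_triangle.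
- apply: (inf_limit_le (u := fun w => w.1.1) (v := fun w => mdist A B + w.1.2) L) => //.
  + by apply: cvgD => //; exact: cvg_cst.
  + by move=> P /=; rewrite metric_triangle.
- apply: (inf_limit_le (u := fun w => w.1.2) (v := fun w => mdist A B + w.1.1) L) => //.
  + by apply: cvgD => //; exact: cvg_cst.
  + by move=> P /=; rewrite (metric_sym A B) metric_triangle.
- apply: (inf_limit_le (u := fun=> 0) (v := fun w => w.1.1) L) => //.
  + exact: cvg_cst.
  + by move=> P /=; rewrite mdist_ge0.
Qed.

Lemma continuous_hinge (T : topologicalType) (u v : T -> R) k rho (x : T) :
  {for x, continuous u} -> {for x, continuous v} ->
  {for x, continuous (fun y => hinge k (u y) (v y) rho)}.
Proof.
move=> cu cv.
have ch (f : T -> R) : {for x, continuous f} -> {for x, continuous (chord2 k \o f)}.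
  by move=> cf; apply: continuous_comp => //; exact: continuous_chord2.
have sh (f : T -> R) : {for x, continuous f} -> {for x, continuous (sn k \o f)}.
  by move=> cf; apply: continuous_comp => //; exact: continuous_sn.
rewrite /hinge; apply: cvgB; first apply: cvgB; first apply: cvgD.
- exact: ch.
- exact: ch.
- apply: cvgM; last exact: ch.
  by apply: cvgM; [exact: cvg_cst|exact: ch].
- apply: cvgM; last exact: cvg_cst.
  apply: cvgM; last exact: sh.
  by apply: cvgM; [exact: cvg_cst|exact: sh].
Qed.

(** The first variation at a near minimizer.  The inequalities that make the
    move of CAT_decrease profitable are strict at the limit, hence hold at
    points that are close to it. *)
Lemma inf_limit_angle k A B C g p q r : CAT X k -> inf_limit A B C g (p, q, r) ->
    Num.sqrt k * p <= pi / 2 -> Num.sqrt k * q <= pi / 2 ->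
    Num.sqrt k * mdist A B <= pi / 2 ->
  hinge120 k p q <= chord2 k (mdist A B).
Proof.
move=> catX L kp kq kc; rewrite leNgt; apply/negP => H.
have kk := sqrtr_ge0 k; have pi0 := pi_gt0 R.
have [cpq tp tq p0] := inf_limit_tri L.
have [_ _ _ q0] := inf_limit_tri (inf_limit_swap12 L).
have c0 := mdist_ge0 A B; have sumz := inf_limit_sum L.
set c := mdist A B in H kc cpq tp tq c0.
have [p00|pn] := eqVneq p 0.
  rewrite p00 hinge_0l in H.
  by rewrite (_ : c = q) ?ltxx// in H; lra.
have [q00|qn] := eqVneq q 0.
  rewrite q00 hingeC hinge_0l in H.
  by rewrite (_ : c = p) ?ltxx// in H; lra.
have {}p0 : 0 < p by rewrite lt_neqAle eq_sym pn.
have {}q0 : 0 < q by rewrite lt_neqAle eq_sym qn.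
have clt : c < p + q.
  rewrite lt_neqAle cpq andbT; apply/eqP => cE; move: H; rewrite cE ltNge.
  rewrite hinge120E => /negP; apply.
  have : chord2 k (p - q) <= chord2 k (p + q).
    rewrite -subr_ge0 chord2B mulr_ge0// ?mulr_ge0//; apply: sn_ge0; lra.
  lra.
(* an angle 2 arccos rho < 120 degrees that is still larger than the limit of
   the comparison angles *)
have [rho [rho2 rho1 Hrho]] : exists rho, [/\ 2^-1 < rho, rho < 1 &
    chord2 k c < hinge k p q (2 * rho ^+ 2 - 1)].
  apply: (@filter_ex _ (2^-1)^'+); near=> rho; split; near: rho.
  - exact: nbhs_right_gt.
  - by apply: nbhs_right_lt; lra.
  - apply: cvg_within; apply: (@near_lt_continuous R (fun=> chord2 k c)
      (fun rho => hinge k p q (2 * rho ^+ 2 - 1))).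
    + exact: cvg_cst.
    + rewrite /hinge; apply/differentiable_continuous/derivable1_diffP.
      exact: ex_derive.
    + by rewrite (_ : 2 * (2^-1) ^+ 2 - 1 = - 2^-1)//; field.
have rho01 : 0 <= rho <= 1.
  by rewrite (ltW rho1) andbT; apply/ltW/(lt_trans _ rho2); rewrite invr_gt0.
pose tau := (rho + 2^-1) / 2.
have tau2 : 2^-1 < tau by rewrite /tau; lra.
have tau1 : tau < 1 by rewrite /tau; lra.
have taur : tau < rho by rewrite /tau; lra.
pose m := Num.min ((p + q - c) / 2) (Num.min p q).
have m0 : 0 < m by rewrite !lt_min p0 q0 !andbT divr_gt0//; lra.
have klt x : Num.sqrt k * x <= pi / 2 -> Num.sqrt k * x < pi by lra.
have [s [s0 sm fp fq]] : exists s, [/\ 0 < s, s < m,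
    hinge k p s rho < chord2 k (p - tau * s) &
    hinge k q s rho < chord2 k (q - tau * s)].
  apply: (@filter_ex _ 0^'+); near=> s; split; near: s => //.
  - exact: nbhs_right_gt.
  - exact: nbhs_right_lt.
  - by apply: first_variation => //; exact: klt.
  - by apply: first_variation => //; exact: klt.
move: sm; rewrite /m !lt_min => /and3P[sm sp sq].
have ts : tau * s < s by rewrite -[X in _ < X]mul1r ltr_pM2r.
have ts2 : 2^-1 * s < tau * s by rewrite ltr_pM2r.
have c1 := @continuous_c1 (p, q, r); have c2 := @continuous_c2 (p, q, r).
have c3 := @continuous_c3 (p, q, r).
have cc d : {for (p, q, r), continuous (fun=> d : R)} by exact: cvg_cst.
have cch (u : R * R * R -> R) : {for (p, q, r), continuous u} ->
    {for (p, q, r), continuous (fun w => chord2 k (u w - tau * s))}.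
  move=> cu; apply: (@continuous_comp _ _ _ (fun w => u w - tau * s) (chord2 k)).
    by apply: cvgB => //; exact: cc.
  exact: continuous_chord2.
have N1 := near_lt_continuous (cc (chord2 k c))
  (@continuous_hinge _ _ _ k (2 * rho ^+ 2 - 1) _ c1 c2) Hrho.
have N2 := near_lt_continuous (@continuous_hinge _ _ _ k rho _ c1 (cc s))
  (cch _ c1) fp.
have N3 := near_lt_continuous (@continuous_hinge _ _ _ k rho _ c2 (cc s))
  (cch _ c2) fq.
have c12 : {for (p, q, r), continuous (fun w => w.1.1 + w.1.2)} by exact: cvgD.
have c123 : {for (p, q, r), continuous (fun w => w.1.1 + w.1.2 + w.2)}.
  exact: cvgD.
have ckc : {for (p, q, r), continuous (fun w => Num.sqrt k * (w.1.1 + w.1.2 + c))}.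
  by apply: cvgM; [exact: cc|apply: cvgD; [exact: c12|exact: cc]].
have N4 := near_lt_continuous (cc (c + 2 * s)) c12 ltac:(rewrite /=; lra).
have N5 := near_lt_continuous (cc (tau * s)) c1 (lt_trans ts sp).
have N6 := near_lt_continuous (cc (tau * s)) c2 (lt_trans ts sq).
have N7 := near_lt_continuous ckc (cc (2 * pi)) ltac:(rewrite /=; lra).
have N8 := near_lt_continuous c123 (cc (g + (2 * tau - 1) * s)) ltac:(rewrite /=; lra).
have [lb h] := L.
have [] := h _ 1 (filterI N1 (filterI N2 (filterI N3 (filterI N4
  (filterI N5 (filterI N6 (filterI N7 N8))))))) ltr01.
move=> P [] /= h1 [] h2 [] h3 [] h4 [] h5 [] h6 [] h7 h8 _.
rewrite !(metric_sym _ P) in h1 h2 h3 h4 h5 h6 h7 h8.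
have ts0 : 0 < tau * s by apply: lt_trans ts2; rewrite mulr_gt0 ?invr_gt0.
have c2s : c < c + 2 * s by rewrite ltrDl mulr_gt0.
have [Q [dA dB dP]] : exists Q, [/\ mdist A Q <= mdist P A - tau * s,
    mdist B Q <= mdist P B - tau * s & mdist P Q = s].
  exact: (CAT_decrease catX rho01 h7 (lt_trans ts0 h5) (lt_trans ts0 h6) h1
    (ltW s0) (ltW h4) (lt_trans c2s h4) (ltW h5) (ltW h6) h2 h3).
have gQ := lb Q; have tri := metric_triangle C P Q.
rewrite /sum_dist in gQ; rewrite (metric_sym C P) dP in tri.
move: gQ tri dA dB h8; clear.
move: (mdist A Q) (mdist B Q) (mdist C Q) (mdist P A) (mdist P B) (mdist P C).
move=> *; lra.
Unshelve. all: by end_near. Qed.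

End InfLimit.

(** * Tripods in two curvatures *)

Section Tripods.
Set Implicit Arguments.
Unset Strict Implicit.
Context {R : realType}.
Implicit Types (k l p q r s t a b c e h rho tau : R).

Lemma hinge120_ge_rigid k q r q' r' : 0 <= q' -> 0 <= r' -> q' <= q -> r' <= r ->
    Num.sqrt k * q <= pi / 2 -> Num.sqrt k * r <= pi / 2 ->
    hinge120 k q r <= hinge120 k q' r' ->
  q = q' /\ r = r'.
Proof.
move=> q0 r0 qq rr kq kr H.
have kr' := sqrtM_le rr kr; have kq' := sqrtM_le qq kq.
have h1 : hinge120 k q' r' <= hinge120 k q r' by apply: hinge120_le_leg.
have h2 : hinge120 k q r' <= hinge120 k q r.
  by rewrite !(hingeC _ q); apply: hinge120_le_leg => //; apply: le_trans qq.
split; apply/eqP; rewrite eq_le ?qq ?rr andbT leNgt; apply/negP => lt.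
  by have := hinge120_lt_leg q0 lt r0 kq kr'; lra.
have := hinge120_lt_leg r0 lt (le_trans q0 qq) kr kq.
by rewrite !(hingeC _ _ q); lra.
Qed.

(** Of the two legs that q and r replace, let r' be the one that is shortened
    less, by e; then p exceeds p' by at least 2 e. *)
Lemma hinge120_exchange k p q r p' q' r' : 0 <= p' -> 0 <= q -> 0 <= r ->
    q < q' -> r < r' -> p' + q' + r' <= p + q + r ->
    Num.sqrt k * p <= pi / 2 -> Num.sqrt k * q' <= pi / 2 ->
    Num.sqrt k * r' <= pi / 2 ->
    hinge120 k p q <= hinge120 k p' q' -> hinge120 k p r <= hinge120 k p' r' ->
  False.
Proof.
move=> p0 q0 r0; wlog : q r q' r' q0 r0 / r' - r <= q' - q.
  move=> W qq rr s kp kq kr Hq Hr; have [le|le] := leP (r' - r) (q' - q).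
    exact: (W q r q' r').
  by apply: (W r q r' q') => //; lra.
move=> le _ rr s kp _ kr _ H.
have e0 : 0 < r' - r by lra.
have er : r' - r <= r' by lra.
have kp' : Num.sqrt k * (p' + 2 * (r' - r)) <= pi / 2.
  by apply: sqrtM_le kp; lra.
have := hinge120_exchange_lt p0 e0 er kp' kr.
rewrite (_ : r' - (r' - r) = r); last by ring.
have : hinge120 k (p' + 2 * (r' - r)) r <= hinge120 k p r.
  apply: hinge120_le_leg => //; try lra.
  by apply: sqrtM_le kr; lra.
lra.
Qed.

Lemma tripod_rigid k p q r p' q' r' :
    0 <= p -> 0 <= q -> 0 <= r -> 0 <= p' -> 0 <= q' -> 0 <= r' ->
    p + q + r = p' + q' + r' ->
    [/\ Num.sqrt k * p <= pi / 2, Num.sqrt k * q <= pi / 2 &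
        Num.sqrt k * r <= pi / 2] ->
    [/\ Num.sqrt k * p' <= pi / 2, Num.sqrt k * q' <= pi / 2 &
        Num.sqrt k * r' <= pi / 2] ->
    hinge120 k p q <= hinge120 k p' q' -> hinge120 k p r <= hinge120 k p' r' ->
    hinge120 k q r <= hinge120 k q' r' ->
  [/\ p = p', q = q' & r = r'].
Proof.
move=> p0 q0 r0 p0' q0' r0' s [kp kq kr] [kp' kq' kr'] Hpq Hpr Hqr.
have [lp|lp] := leP p' p; have [lq|lq] := leP q' q; have [lr|lr] := leP r' r.
- have [] := hinge120_ge_rigid p0' q0' lp lq kp kq Hpq; split => //; lra.
- have [] := hinge120_ge_rigid p0' q0' lp lq kp kq Hpq; split => //; lra.
- have [] := hinge120_ge_rigid p0' r0' lp lr kp kr Hpr; split => //; lra.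
- exfalso; apply: (hinge120_exchange p0' q0 r0 lq lr _ kp kq' kr' Hpq Hpr); lra.
- have [] := hinge120_ge_rigid q0' r0' lq lr kq kr Hqr; split => //; lra.
- exfalso; apply: (hinge120_exchange q0' p0 r0 lp lr _ kq kp' kr' _ Hqr); first lra.
  by rewrite !(hingeC _ q) ?(hingeC _ q').
- exfalso; apply: (hinge120_exchange r0' p0 q0 lp lq _ kr kp' kq'); first lra.
    by rewrite hingeC (hingeC _ r').
  by rewrite hingeC (hingeC _ r').
- exfalso; lra.
Qed.

Lemma hinge120_curv k l p q c : k < l -> 0 <= p -> 0 <= q ->
    `|p - q| <= c <= p + q -> 0 < c -> Num.sqrt l * (c + (p + q)) < 2 * pi ->
    chord2 l c <= hinge120 l p q ->
  chord2 k c <= hinge120 k p q /\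
  (0 < p -> 0 < q -> chord2 k c < hinge120 k p q).
Proof.
move=> kl p0 q0 /andP[h1 h2] c0 per H.
have strict : 0 < p -> 0 < q -> chord2 k c < hinge120 k p q.
  by move=> p0' q0'; apply: hinge120_lt_curv kl p0' q0' h1 h2 c0 per H.
split => //.
have [pz|pn] := eqVneq p 0.
  rewrite pz hinge_0l; rewrite pz sub0r ler_norml in h1.
  by rewrite (_ : c = q)//; lra.
have [qz|qn] := eqVneq q 0.
  rewrite qz hingeC hinge_0l; rewrite qz subr0 ler_norml in h1.
  by rewrite (_ : c = p)//; lra.
by apply/ltW/strict; rewrite lt_neqAle eq_sym ?pn ?qn.
Qed.

(** Lambda is the curvature in which the angle between the sides a and b is
    120 degrees.  A perimeter of 2 pi / sqrt l would give
    cos c = cos (a + b), which is incompatible with this angle. *)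
Lemma isLambda_hinge120 a b c l : 0 < a -> a <= b -> b <= c ->
    isLambda a b c l%:E ->
  [/\ c < a + b, Num.sqrt l * (a + b + c) < 2 * pi & chord2 l c = hinge120 l a b].
Proof.
move=> a0 ab bc [cab H]; have pi0 := pi_gt0 R.
have cs_hinge : l != 0 -> cs l c = cs l a * cs l b - l / 2 * (sn l a * sn l b) ->
    chord2 l c = hinge120 l a b.
  move=> l0; rewrite !csE /hinge => E.
  have : l / 2 * (chord2 l c - (chord2 l a + chord2 l b
    - l / 2 * chord2 l a * chord2 l b - 2 * sn l a * sn l b * - 2^-1)) = 0 by lra.
  move=> /eqP; rewrite mulf_eq0 mulf_eq0 invr_eq0 (negbTE l0) pnatr_eq0 /=.
  by rewrite subr_eq0 => /eqP.
case: H => [[E l0]|[_ /andP[l0 lS] /= E]|[_ l0 /= E]]; split => //.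
- by rewrite l0 sqrtr0 mul0r; lra.
- by rewrite l0 /hinge !chord2_flat !sn_flat E; field.
- set r := Num.sqrt l in E *.
  have r0 : 0 < r by rewrite sqrtr_gt0.
  have S0 : 0 < a + b + c by lra.
  have rS : r <= 2 * pi / (a + b + c).
    by rewrite -(@ler_pXn2r _ 2)// ?nnegrE ?(ltW r0) ?divr_ge0 ?mulr_ge0 ?(ltW S0) ?(ltW pi0)// sqr_sqrtr// ltW.
  rewrite ler_pdivlMr// in rS; rewrite lt_neqAle rS andbT; apply/eqP => eqS.
  have ra : 0 < r * a by rewrite mulr_gt0.
  have rab : r * a <= r * b by rewrite ler_pM2l.
  have rbc : r * b <= r * c by rewrite ler_pM2l.
  have sa : 0 < sin (a * r) by rewrite mulrC sin_gt0_pi//; apply/andP; split; lra.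
  have sb : 0 < sin (b * r) by rewrite mulrC sin_gt0_pi//; apply/andP; split; lra.
  have : cos (c * r) = cos (a * r + b * r).
    have -> : c * r = - (a * r + b * r) + pi *+ 2 by lra.
    by rewrite cosD2pi cosN.
  rewrite E cosD; have : 0 < sin (a * r) * sin (b * r) by rewrite mulr_gt0.
  lra.
- apply: cs_hinge; first by rewrite gt_eqF.
  rewrite /cs /sn l0 !(mulrC (Num.sqrt l)) E.
  have h := sqrt_neq0 l0; congr (_ - _).
  move: (sin _) (sin _) => x y.
  move: (Num.sqrt l) h (sqr_sqrt_pos l0) => r h <-; by field.
- by rewrite sqrt_npos ?(ltW l0)// mul0r; lra.
- apply: cs_hinge; first by rewrite lt_eqF.
  rewrite /cs /sn ltNge (ltW l0) /= l0 !(mulrC (Num.sqrt (- l))) E.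
  have l0' : 0 < - l by lra.
  have h := sqrt_neq0 l0'; congr (_ + _).
  move: (sinh _) (sinh _) => x y.
  move: (Num.sqrt (- l)) h (sqr_sqrt_pos l0') => r h hl.
  by rewrite (_ : l = - r ^+ 2); [field|lra].
Qed.

(** If k < l, the tripods agree by tripod_rigid.  At most one of the legs
    vanishes, and the hinge on the two others is strictly longer in curvature k
    than in curvature l. *)
Lemma tripods_curv_le k l a b c p q r x y z :
    0 < a -> 0 < b -> 0 < c ->
    [/\ 0 <= p, 0 <= q & 0 <= r] ->
    [/\ p <= b, q <= a & r <= a] -> [/\ p <= c, q <= c & r <= b] ->
    [/\ `|p - q| <= c <= p + q, `|p - r| <= b <= p + r & `|q - r| <= a <= q + r] ->
    Num.sqrt l * (a + b + c) < 2 * pi ->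
    [/\ chord2 l c <= hinge120 l p q, chord2 l b <= hinge120 l p r &
        chord2 l a <= hinge120 l q r] ->
    [/\ 0 <= x, 0 <= y & 0 <= z] -> [/\ x <= c, y <= c & z <= c] ->
    b <= c ->
    Num.sqrt k * c <= pi / 2 ->
    [/\ hinge120 k x y <= chord2 k c, hinge120 k x z <= chord2 k b &
        hinge120 k y z <= chord2 k a] ->
    x + y + z = p + q + r ->
  l <= k.
Proof.
move=> a0 b0 c0 [p0 q0 r0] [pb qa ra] [pc qc rb] [tpq tpr tqr] per [Hpq Hpr Hqr].
move=> [x0 y0 z0] [xc yc zc] bc kc [Hxy Hxz Hyz] s.
rewrite leNgt; apply/negP => kl.
have le_per d : d <= a + b + c -> Num.sqrt l * d < 2 * pi.
  by move=> h; apply: le_lt_trans per; rewrite ler_wpM2l ?sqrtr_ge0.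
have pera : a + (q + r) <= a + b + c by lra.
have perb : b + (p + r) <= a + b + c by lra.
have perc : c + (p + q) <= a + b + c by lra.
have [wpq spq] := hinge120_curv kl p0 q0 tpq c0 (le_per _ perc) Hpq.
have [wpr spr] := hinge120_curv kl p0 r0 tpr b0 (le_per _ perb) Hpr.
have [wqr sqr] := hinge120_curv kl q0 r0 tqr a0 (le_per _ pera) Hqr.
have kle d : d <= c -> Num.sqrt k * d <= pi / 2 by move=> h; apply: sqrtM_le kc.
have [||xp yq zr] := tripod_rigid x0 y0 z0 p0 q0 r0 s _ _
  (le_trans Hxy wpq) (le_trans Hxz wpr) (le_trans Hyz wqr).
- by split; exact: kle.
- by split; apply: kle => //; apply: le_trans bc.
rewrite xp yq zr in Hxy Hxz Hyz.
have [p00|pn] := eqVneq p 0.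
  rewrite p00 !add0r in tpq tpr.
  have q0' : 0 < q by case/andP: tpq => _; exact: lt_le_trans.
  have r0' : 0 < r by case/andP: tpr => _; exact: lt_le_trans.
  by have := sqr q0' r0'; rewrite ltNge Hyz.
have p0' : 0 < p by rewrite lt_neqAle eq_sym pn.
have [q00|qn] := eqVneq q 0.
  rewrite q00 !add0r in tqr.
  have r0' : 0 < r by case/andP: tqr => _; exact: lt_le_trans.
  by have := spr p0' r0'; rewrite ltNge Hxz.
have q0' : 0 < q by rewrite lt_neqAle eq_sym qn.
by have := spq p0' q0'; rewrite ltNge Hxy.
Qed.

(** In curvatures below Lambda the angle between a and b is at most 120 degrees,
    which is what model_fermat asks for at the vertex. *)
Lemma minS_tripod a b c l L s : 0 < a -> a <= b -> b <= c ->
    isLambda a b c L%:E -> l <= L -> minS a b c l%:E s ->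
  Num.sqrt l * (a + b + c) < 2 * pi /\
  exists p q r, [/\ [/\ 0 <= p, 0 <= q & 0 <= r],
    [/\ p <= b, q <= a & r <= a] /\ [/\ p <= c, q <= c & r <= b],
    [/\ `|p - q| <= c <= p + q, `|p - r| <= b <= p + r & `|q - r| <= a <= q + r],
    [/\ chord2 l c <= hinge120 l p q, chord2 l b <= hinge120 l p r &
        chord2 l a <= hinge120 l q r] &
    s = p + q + r].
Proof.
move=> a0 ab bc isL lL [_ [A [B [C [[mA mB mC] [eBC eAC eAB] [P tP sE] minP]]]]].
have pi0 := pi_gt0 R.
have [cltab perL HL] := isLambda_hinge120 a0 ab bc isL.
have per : Num.sqrt l * (a + b + c) < 2 * pi.
  by apply: sqrtM_mono_lt lL _ perL; lra.
split=> //.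
have lc : Num.sqrt l * c < pi.
  suff : Num.sqrt l * (2 * c) < 2 * pi by lra.
  by apply: le_lt_trans per; rewrite ler_wpM2l ?sqrtr_ge0//; lra.
have vert : chord2 l c <= hinge120 l a b.
  move: lL; rewrite le_eqVlt => /orP[/eqP->|lL]; first by rewrite HL.
  apply/ltW/(hinge120_lt_curv lL) => //; try lra.
  by rewrite ler_norml; apply/andP; split; lra.
have triE Q : model_triangle l A B C Q <-> cone l A B C Q.
  by apply: model_triangleE => //; rewrite eBC eAC eAB.
have mn : cone_min l A B C P.
  by split; [exact/triE|move=> Q /triE/minP; rewrite -sE].
have [[pb pc qa qc] [ra rb] nn tri H] :=
  model_fermat mA mB mC mn eBC eAC eAB a0 ab bc lc vert.
by exists (model_dist l P A), (model_dist l P B), (model_dist l P C).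
Qed.

End Tripods.

Section CATTripod.
Set Implicit Arguments.
Unset Strict Implicit.
Context {R : realType} {X : metricType R}.

(** As the sum of the legs is at most the sum of two sides, each leg is bounded by
    a side, which gives the range where inf_limit_angle applies. *)
Lemma CAT_tripod (k d : R) (A B C : X) : CAT X k ->
    [/\ mdist A B <= d, mdist A C <= d & mdist B C <= d] ->
    Num.sqrt k * d <= pi / 2 ->
  exists x y z : R, [/\ [/\ 0 <= x, 0 <= y & 0 <= z], [/\ x <= d, y <= d & z <= d],
    [/\ hinge120 k x y <= chord2 k (mdist A B),
        hinge120 k x z <= chord2 k (mdist A C) &
        hinge120 k y z <= chord2 k (mdist B C)] &
    x + y + z = min_sum_dist A B C].
Proof.
move=> catX [ABd ACd BCd] kd; have [[[x y] z] L] := inf_limit_exists A B C.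
have sumE := inf_limit_sum L.
have L12 := inf_limit_swap12 L; have L23 := inf_limit_swap23 L.
have L231 := inf_limit_swap23 L12; have L312 := inf_limit_swap12 L23.
have [t1 _ _ x0] := inf_limit_tri L; have [t2 _ _ _] := inf_limit_tri L23.
have [t3 _ _ y0] := inf_limit_tri L231; have [_ _ _ z0] := inf_limit_tri L312.
have fA := (proj1 L) A; have fB := (proj1 L) B.
move: fA fB; rewrite /sum_dist !mdistxx (metric_sym B A) (metric_sym C A).
rewrite (metric_sym C B) -sumE.
have kle e : e <= d -> Num.sqrt k * e <= pi / 2 by move=> h; apply: sqrtM_le kd.
move=> fA fB.
have [xd yd zd] : [/\ x <= d, y <= d & z <= d].
  move: t1 t2 t3 fA fB ABd ACd BCd; clear.
  move: (mdist A B) (mdist A C) (mdist B C) => c b a *.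
  by split; lra.
exists x, y, z; split => //; split.
- exact: inf_limit_angle catX L (kle _ xd) (kle _ yd) (kle _ ABd).
- exact: inf_limit_angle catX L23 (kle _ xd) (kle _ zd) (kle _ ACd).
- exact: inf_limit_angle catX L231 (kle _ yd) (kle _ zd) (kle _ BCd).
Qed.

Lemma size_bound_quarter (k d : R) : (d%:E <= size_bound k)%E ->
  Num.sqrt k * d <= pi / 2.
Proof.
rewrite /size_bound; case: ifP => k0 h.
  by move: h; rewrite lee_fin invfM mulrA ler_pdivlMr ?sqrtr_gt0//; lra.
by rewrite sqrt_npos ?mul0r ?divr_ge0 ?pi_ge0// leNgt k0.
Qed.

Lemma mdist_le_max (A B C x y : X) : [set A; B; C] x -> [set A; B; C] y ->
  mdist x y <= Num.max (mdist A B) (Num.max (mdist A C) (mdist B C)).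
Proof.
have M0 : 0 <= Num.max (mdist A B) (Num.max (mdist A C) (mdist B C)).
  by rewrite le_max mdist_ge0.
by move=> [[]|] -> [[]|] ->; rewrite ?mdistxx// ?(metric_sym C) ?(metric_sym B A)
  !le_max lexx ?orbT.
Qed.

End CATTripod.

Theorem theorem5p1 (R : realType) (k : R) (X : metricType R) (hX : CAT X k)
    (A B C : X) (hAB : A <> B) (hAC : A <> C) (hBC : B <> C)
    (hmax : ((Num.max (mdist A B) (Num.max (mdist A C) (mdist B C)))%:E
             <= size_bound k)%E)
    (kT : \bar R) (hkT : triple_curvature [set A; B; C] kT) :
  (kT <= k%:E)%E.
Proof.
have [p1 [p2 [p3 [TE [n12 n13 n23] [ab bc _] [L isL lL] lS]]]] := hkT.
have [T1 T2 T3] : [/\ [set A; B; C] p1, [set A; B; C] p2 & [set A; B; C] p3].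
  by rewrite TE; split; [left; left|left; right|right].
have := sqrtM_le (mdist_le_max T1 T3) (size_bound_quarter hmax) => kc.
have a0 : 0 < mdist p1 p2 by rewrite mdist_gt0; apply/eqP.
case: kT hkT lL lS => [l|_ _ []|*]; last by rewrite leNye.
case: L isL => [L|//|//] isL _; rewrite !lee_fin => lL lS.
have [per [p [q [r [nn [le1 le2] tri H sE]]]]] := minS_tripod a0 ab bc isL lL lS.
have d13 : [/\ mdist p3 p1 <= mdist p1 p3, mdist p3 p2 <= mdist p1 p3 &
    mdist p1 p2 <= mdist p1 p3].
  by rewrite !(metric_sym p3) lexx bc (le_trans ab).
have [x [y [z [xyz0 xyzc]]]] := CAT_tripod hX d13 kc.
rewrite !(metric_sym p3) => HX sX.
have b0 := lt_le_trans a0 ab; have c0 := lt_le_trans b0 bc.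
apply: (tripods_curv_le a0 b0 c0 nn le1 le2 tri per H xyz0 xyzc bc kc HX).
rewrite sX -sE /min_sum_dist.
suff -> : (fun u : X => mdist p3 u + mdist p1 u + mdist p2 u) =
    (fun u : X => mdist p1 u + mdist p2 u + mdist p3 u) by [].
by apply/funext => u; ring.
Qed.
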